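(* Let $M$ be a contact CR-submanifold of a Kenmotsu manifold $\overline{M}^{2n+1}(\phi,\xi,\eta,g)$ equipped with the semisymmetric metric connection $\widetilde{\overline{\nabla}}_XY=\overline{\nabla}_XY+\eta(Y)X-g(X,Y)\xi$, where $\overline{\nabla}$ is the Levi-Civita connection of $g$. Let $h$ and $\widetilde{h}$ be the second fundamental forms of $M$ with respect to $\overline{\nabla}$ and $\widetilde{\overline{\nabla}}$. Then the following statements are equivalent: (i) $M$ is totally geodesic, i.e. $h=0$; (ii) $M$ is parallel with respect to the semisymmetric metric connection, i.e. $\widetilde{\nabla}\widetilde{h}=0$; (iii) $M$ is semiparallel with respect to the semisymmetric metric connection, i.e. $\widetilde{\overline{R}}(X,Y)\cdot\widetilde{h}=0$ for all vector fields $X,Y$ tangent to $M$; (iv) $M$ is pseudo parallel in the sense of Chaki with respect to the semisymmetric metric connection with $\alpha(\xi)\neq -2$, i.e. there is a nowhere vanishing $1$-form $\alpha$ on $M$ with $\alpha(\xi)\neq -2$ at every point of $M$ such that $(\widetilde{\nabla}_X\widetilde{h})(Y,Z)=2\alpha(X)\widetilde{h}(Y,Z)+\alpha(Y)\widetilde{h}(X,Z)+\alpha(Z)\widetilde{h}(X,Y)$ for all vector fields $X,Y,Z$ tangent to $M$; (v) $M$ is pseudo parallel in the sense of Deszcz with respect to the semisymmetric metric connection with $L_1\neq 2$, i.e. there is a real-valued function $L_1$ on $M$ with $L_1\neq 2$ at every point of $M$ such that $(\widetilde{\overline{R}}(X,Y)\cdot\widetilde{h})(Z,U)=L_1\,Q(g,\widetilde{h})(Z,U;X,Y)$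 for all vector fields $X,Y,Z,U$ tangent to $M$.
   Context: Kenmotsu manifold: a smooth manifold $\overline{M}^{2n+1}$ with a $(1,1)$-tensor field $\phi$, a vector field $\xi$, a $1$-form $\eta$ and a Riemannian metric $g$ such that $\phi\xi=0$, $\eta(\phi X)=0$, $\phi^2X=-X+\eta(X)\xi$, $g(\phi X,Y)=-g(X,\phi Y)$, $\eta(X)=g(X,\xi)$, $\eta(\xi)=1$, $g(\phi X,\phi Y)=g(X,Y)-\eta(X)\eta(Y)$, and, with $\overline{\nabla}$ the Levi-Civita connection of $g$, $\overline{\nabla}_X\xi=X-\eta(X)\xi$ and $(\overline{\nabla}_X\phi)Y=g(\phi X,Y)\xi-\eta(Y)\phi X$. Contact CR-submanifold: an isometrically immersed submanifold $M$ of $\overline{M}$ carrying a differentiable distribution $D:p\mapsto D_p\subseteq T_pM$ such that $\xi\in D$ (in particular $\xi$ is tangent to $M$), $\phi(D_p)\subseteq D_p$ for all $p\in M$, and the orthogonal complementary distribution $D^\bot$ of $D$ in $TM$ satisfies $\phi(D^\bot_p)\subseteq T^\bot_pM$ for all $p\in M$. For $X,Y$ tangent and $V$ normal to $M$: $\overline{\nabla}_XY=\nabla_XY+h(X,Y)$ and $\widetilde{\overline{\nabla}}_XY=\widetilde{\nabla}_XY+\widetilde{h}(X,Y)$ are the decompositions into tangential and normal parts ($\nabla,\widetilde{\nabla}$ the induced connections, $h,\widetilde{h}$ the second fundamental forms), and $\widetilde{\nabla}^\bot_XV$ is the normal part of $\widetilde{\overline{\nabla}}_XV$. The covariant derivative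 of $\widetilde{h}$ is $(\widetilde{\nabla}_X\widetilde{h})(Y,Z)=\widetilde{\nabla}^\bot_X\widetilde{h}(Y,Z)-\widetilde{h}(\widetilde{\nabla}_XY,Z)-\widetilde{h}(Y,\widetilde{\nabla}_XZ)$. Let $\widetilde{R}(X,Y)=[\widetilde{\nabla}_X,\widetilde{\nabla}_Y]-\widetilde{\nabla}_{[X,Y]}$ and $\widetilde{R}^\bot(X,Y)=[\widetilde{\nabla}^\bot_X,\widetilde{\nabla}^\bot_Y]-\widetilde{\nabla}^\bot_{[X,Y]}$. For $X,Y,Z,U$ tangent to $M$, $(\widetilde{\overline{R}}(X,Y)\cdot\widetilde{h})(Z,U)=\widetilde{R}^\bot(X,Y)\widetilde{h}(Z,U)-\widetilde{h}(\widetilde{R}(X,Y)Z,U)-\widetilde{h}(Z,\widetilde{R}(X,Y)U)$, and $Q(g,\widetilde{h})(Z,U;X,Y)=g(Y,Z)\widetilde{h}(X,U)-g(X,Z)\widetilde{h}(Y,U)+g(Y,U)\widetilde{h}(X,Z)-g(X,U)\widetilde{h}(Y,Z)$. *)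

(* Defs.v *)
From HB Require Import structures.
From mathcomp Require Import all_boot all_order all_algebra.
From mathcomp Require Import all_classical all_reals all_analysis.

Set Implicit Arguments.
Unset Strict Implicit.
Unset Printing Implicit Defensive.
Import Order.TTheory GRing.Theory Num.Theory.
Import numFieldNormedType.Exports.
Local Open Scope classical_set_scope.
Local Open Scope ring_scope.

Fixpoint Ck (R : realType) (V W : normedModType R) (k : nat) (A : set V)
    (F : V -> W) : Prop :=
  match k with
  | 0%N => forall x, A x -> {for x, continuous F}
  | k'.+1 => (forall x, A x -> differentiable F x) /\
             (forall v : V, Ck k' A ('D_v F))
  end.

(* C^oo on A; only used for open sets A of V = R^n. *)
Definition smooth_on (R : realType) (V W : normedModType R) (A : set V)
    (F : V -> W) : Prop :=
  forall k, Ck k A F.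

(* An atlas indexed by the points of the manifold: [chart p] is a chart around
   [p], with domain [dom p] and inverse [ichart p]. Both are total functions
   whose values outside [dom p], resp. [chart p @` dom p], are irrelevant. *)
Record manifold (R : realType) (n : nat) := Manifold {
  points :> topologicalType;
  dom : points -> set points;
  chart : points -> points -> 'rV[R]_n;
  ichart : points -> 'rV[R]_n -> points;
  manifold_hausdorff : hausdorff_space points;
  manifold_countable : @second_countable points;
  dom_open : forall p, open (dom p);
  dom_mem : forall p, dom p p;
  chart_open : forall p, open (chart p @` dom p);
  chartK : forall p q, dom p q -> ichart p (chart p q) = q;
  chart_continuous : forall p q, dom p q -> {for q, continuous (chart p)};
  ichart_continuous : forall p x, (chart p @` dom p) x ->
    {for x, continuous (ichart p)};
  transition_smooth : forall p q,
    smooth_on (chart p @` (dom p `&` dom q)) (chart q \o ichart p)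
}.

Section Fields.
Context {R : realType} {n : nat} {M : manifold R n}.

(* F is C^oo on a neighbourhood of p. *)
Definition smooth_near (W : normedModType R) (F : M -> W) (p : M) : Prop :=
  exists A : set 'rV[R]_n,
    [/\ open A, A (chart p p) & smooth_on A (F \o ichart p)].

(* The tangent space T_pM is 'rV[R]_n: a row v stands for the tangent vector
   with components v in the distinguished chart [chart p] at p. *)
Definition vfield := M -> 'rV[R]_n.

(* v(F), for v in T_pM. *)
Definition dirD (W : normedModType R) (F : M -> W) (p : M) (v : 'rV[R]_n) : W :=
  'D_v (F \o ichart p) (chart p p).

(* Components of X in the single chart [chart p], near p. (The row [X q] itself
   refers to [chart q], which need not depend continuously on q.) *)
Definition comps (p : M) (X : vfield) : vfield :=
  fun q => dirD (chart p) q (X q).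

Definition smooth_vf_near (X : vfield) (p : M) : Prop :=
  smooth_near (comps p X) p.

Definition smooth_vf (X : vfield) : Prop := forall p, smooth_vf_near X p.

(* [X, Y]^k = X(Y^k) - Y(X^k) in local coordinates. *)
Definition bracket (X Y : vfield) : vfield :=
  fun p => dirD (comps p Y) p (X p) - dirD (comps p X) p (Y p).

(* The vector field with constant components w in the chart [chart a]. *)
Definition coord_field (a : M) (w : 'rV[R]_n) : vfield :=
  fun q => 'D_w (chart q \o ichart a) (chart a q).

Definition one_form (alpha : M -> 'rV[R]_n -> R) : Prop :=
  (forall p, scalar (alpha p)) /\
  (forall p X, smooth_vf_near X p ->
     smooth_near (fun q => alpha q (X q) : R) p).

Definition tensor11 (phi : M -> 'rV[R]_n -> 'rV[R]_n) : Prop :=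
  (forall p, linear (phi p)) /\
  (forall p X, smooth_vf_near X p -> smooth_vf_near (fun q => phi q (X q)) p).

Record riemannian (g : M -> 'rV[R]_n -> 'rV[R]_n -> R) : Prop := Riemannian {
  riem_linear : forall p w, scalar (g p ^~ w);
  riem_sym : forall p v w, g p v w = g p w v;
  riem_pos : forall p v, v != 0 -> 0 < g p v v;
  riem_smooth : forall p X Y, smooth_vf_near X p -> smooth_vf_near Y p ->
    smooth_near (fun q => g q (X q) (Y q) : R) p
}.

(* [nb p v Y] is the covariant derivative of Y in the direction v in T_pM. As a
   connection is tensorial in the direction and local in Y, it is given here as
   acting on vector fields Y defined (i.e. smooth) near p. *)
Definition conn := forall p : M, 'rV[R]_n -> vfield -> 'rV[R]_n.

Record connection (nb : conn) : Prop := Connection {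
  conn_local : forall p v Y Y', smooth_vf_near Y p ->
    (\forall q \near p, Y q = Y' q) -> nb p v Y = nb p v Y';
  conn_smooth : forall p X Y, smooth_vf_near X p -> smooth_vf_near Y p ->
    smooth_vf_near (fun q => nb q (X q) Y) p;
  conn_linear : forall p Y, smooth_vf_near Y p -> linear (fun v => nb p v Y);
  conn_add : forall p v Y Z, smooth_vf_near Y p -> smooth_vf_near Z p ->
    nb p v (fun q => Y q + Z q) = nb p v Y + nb p v Z;
  conn_leibniz : forall p v (u : M -> R) Y,
    smooth_near u p -> smooth_vf_near Y p ->
    nb p v (fun q => u q *: Y q) = dirD u p v *: Y p + u p *: nb p v Y
}.

Record levi_civita (g : M -> 'rV[R]_n -> 'rV[R]_n -> R) (nb : conn) : Prop :=
  LeviCivita {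
  lc_connection : connection nb;
  lc_torsion : forall p X Y, smooth_vf_near X p -> smooth_vf_near Y p ->
    nb p (X p) Y - nb p (Y p) X = bracket X Y p;
  lc_metric : forall p v Y Z, smooth_vf_near Y p -> smooth_vf_near Z p ->
    dirD (fun q => g q (Y q) (Z q) : R) p v =
    g p (nb p v Y) (Z p) + g p (Y p) (nb p v Z)
}.

(* R(X, Y) s for an operator D X s on T_pM- or T_pN-valued functions s on M. *)
Definition curvature (k : nat)
    (D : vfield -> (M -> 'rV[R]_k) -> (M -> 'rV[R]_k))
    (X Y : vfield) (s : M -> 'rV[R]_k) : M -> 'rV[R]_k :=
  fun p => D X (D Y s) p - D Y (D X s) p - D (bracket X Y) s p.

End Fields.

Arguments vfield {R n} M.
Arguments conn {R n} M.

Section Kenmotsu.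
Context {R : realType} {N : nat} {Mb : manifold R N}.
Implicit Types (phi : Mb -> 'rV[R]_N -> 'rV[R]_N) (xi : vfield Mb)
  (eta : Mb -> 'rV[R]_N -> R) (g : Mb -> 'rV[R]_N -> 'rV[R]_N -> R).

Record kenmotsu phi xi eta g (nb : conn Mb) : Prop := Kenmotsu {
  ken_phi : tensor11 phi;
  ken_xi : smooth_vf xi;
  ken_eta : one_form eta;
  ken_g : riemannian g;
  ken_lc : levi_civita g nb;
  ken_phi_xi : forall p, phi p (xi p) = 0;
  ken_eta_phi : forall p v, eta p (phi p v) = 0;
  ken_phi2 : forall p v, phi p (phi p v) = - v + eta p v *: xi p;
  ken_phi_skew : forall p v w, g p (phi p v) w = - g p v (phi p w);
  ken_eta_g : forall p v, eta p v = g p v (xi p);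
  ken_eta_xi : forall p, eta p (xi p) = 1;
  ken_g_phi : forall p v w,
    g p (phi p v) (phi p w) = g p v w - eta p v * eta p w;
  ken_nabla_xi : forall p v, nb p v xi = v - eta p v *: xi p;
  ken_nabla_phi : forall p v Y, smooth_vf_near Y p ->
    nb p v (fun q => phi q (Y q)) - phi p (nb p v Y) =
    g p (phi p v) (Y p) *: xi p - eta p (Y p) *: phi p v
}.

Definition semisymmetric xi eta g (nb : conn Mb) : conn Mb :=
  fun p v Y => nb p v Y + eta p (Y p) *: v - g p v (Y p) *: xi p.

End Kenmotsu.

Section Immersion.
Context {R : realType} {m N : nat} {M : manifold R m} {Mb : manifold R N}.
Variable f : M -> Mb.
Implicit Types (g : Mb -> 'rV[R]_N -> 'rV[R]_N -> R) (nb : conn Mb)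
  (X Y Z U : vfield M) (V : M -> 'rV[R]_N).


Definition tmap (p : M) (v : 'rV[R]_m) : 'rV[R]_N :=
  dirD (fun q => chart (f p) (f q)) p v.

Record immersion : Prop := Immersion {
  imm_continuous : continuous f;
  imm_smooth : forall p, smooth_near (fun q => chart (f p) (f q)) p;
  imm_inj : forall p, injective (tmap p)
}.

Definition push X : M -> 'rV[R]_N := fun p => tmap p (X p).

(* The metric on M for which the immersion f is isometric. *)
Definition imetric g (p : M) (v w : 'rV[R]_m) : R :=
  g (f p) (tmap p v) (tmap p w).

Definition normal_vec g (p : M) (v : 'rV[R]_N) : Prop :=
  forall w, g (f p) v (tmap p w) = 0.

(* Orthogonal decomposition v = tmap p (tanp g p v) + norp g p v. *)
Definition tanp g (p : M) (v : 'rV[R]_N) : 'rV[R]_m :=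
  xget 0 [set w | normal_vec g p (v - tmap p w)].

Definition norp g (p : M) (v : 'rV[R]_N) : 'rV[R]_N :=
  v - tmap p (tanp g p v).

(* The covariant derivative in the direction v in T_pM of a vector field V along
   f (V q in T_(f q)Mb). In the chart y of Mb at f p this is the usual formula
   v(V^k) + Gamma^k_ij (df v)^i V^j, where Gamma^k_ij v^i w^j are the components
   of nb applied to the coordinate field w^j d/dy^j in the direction v. *)
Definition pullback nb (p : M) (v : 'rV[R]_m) V : 'rV[R]_N :=
  dirD (fun q => dirD (chart (f p)) (f q) (V q)) p v
  + nb (f p) (tmap p v) (coord_field (f p) (V p)).

Definition inabla g nb X Y : vfield M :=
  fun p => tanp g p (pullback nb p (X p) (push Y)).

Definition sff g nb X Y : M -> 'rV[R]_N :=
  fun p => norp g p (pullback nb p (X p) (push Y)).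

Definition nnabla g nb X V : M -> 'rV[R]_N :=
  fun p => norp g p (pullback nb p (X p) V).

Definition nabla_sff g nb X Y Z : M -> 'rV[R]_N :=
  fun p => nnabla g nb X (sff g nb Y Z) p
           - sff g nb (inabla g nb X Y) Z p - sff g nb Y (inabla g nb X Z) p.

Definition curv_sff g nb X Y Z U : M -> 'rV[R]_N :=
  fun p => curvature (nnabla g nb) X Y (sff g nb Z U) p
           - sff g nb (curvature (inabla g nb) X Y Z) U p
           - sff g nb Z (curvature (inabla g nb) X Y U) p.

Definition Q_sff g nb Z U X Y : M -> 'rV[R]_N :=
  fun p => imetric g p (Y p) (Z p) *: sff g nb X U p
           - imetric g p (X p) (Z p) *: sff g nb Y U p
           + imetric g p (Y p) (U p) *: sff g nb X Z p
           - imetric g p (X p) (U p) *: sff g nb Y Z p.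

(* A smooth subbundle of TM: locally spanned by a frame of smooth fields. *)
Definition smooth_distribution (D : M -> {vspace 'rV[R]_m}) : Prop :=
  forall p, exists E : 'I_(\dim (D p)) -> vfield M,
    (forall i, smooth_vf_near (E i) p) /\
    (\forall q \near p,
       basis_of (D q) [seq E i q | i <- enum 'I_(\dim (D p))]).

Record contact_CR (phi : Mb -> 'rV[R]_N -> 'rV[R]_N) (xi : vfield Mb) g
    (D : M -> {vspace 'rV[R]_m}) : Prop := ContactCR {
  cr_immersion : immersion;
  cr_distribution : smooth_distribution D;
  cr_xi : forall p, exists2 w, w \in D p & xi (f p) = tmap p w;
  cr_invariant : forall p v, v \in D p ->
    exists2 w, w \in D p & phi (f p) (tmap p v) = tmap p w;
  cr_anti_invariant : forall p v,
    (forall w, w \in D p -> imetric g p v w = 0) ->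
    normal_vec g p (phi (f p) (tmap p v))
}.

Definition totally_geodesic g nb : Prop :=
  forall X Y, smooth_vf X -> smooth_vf Y -> forall p, sff g nb X Y p = 0.

Definition parallel g nb : Prop :=
  forall X Y Z, smooth_vf X -> smooth_vf Y -> smooth_vf Z ->
  forall p, nabla_sff g nb X Y Z p = 0.

Definition semiparallel g nb : Prop :=
  forall X Y Z U, smooth_vf X -> smooth_vf Y -> smooth_vf Z -> smooth_vf U ->
  forall p, curv_sff g nb X Y Z U p = 0.

Definition chaki_pseudo_parallel g nb (alpha : M -> 'rV[R]_m -> R) : Prop :=
  forall X Y Z, smooth_vf X -> smooth_vf Y -> smooth_vf Z ->
  forall p, nabla_sff g nb X Y Z p =
    (2 * alpha p (X p)) *: sff g nb Y Z p
    + alpha p (Y p) *: sff g nb X Z p + alpha p (Z p) *: sff g nb X Y p.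

Definition deszcz_pseudo_parallel g nb (L : M -> R) : Prop :=
  forall X Y Z U, smooth_vf X -> smooth_vf Y -> smooth_vf Z -> smooth_vf U ->
  forall p, curv_sff g nb X Y Z U p = L p *: Q_sff g nb Z U X Y p.

End Immersion.

(* Main.v *)
(* Write h for the second fundamental form and xi also for the field it induces
   on M. Since the semisymmetric connection differs from the Levi-Civita one by
   eta(Y) X - g(X, Y) xi, which is tangent to M, both connections have the same
   h. From nabla_X xi = X - eta(X) xi one gets h(X, xi) = 0, and
   tilde-nabla_X xi = 2 (X - eta(X) xi) along M; hence
     (tilde-nabla_X h)(Y, xi) = - 2 h(Y, X),
     (tilde-R(X, xi) . h)(Z, xi) = 2 h(Z, X),  Q(g, h)(Z, xi; X, xi) = h(Z, X),
   so each of (ii)-(v) evaluated at xi forces h = 0. The converses are trivial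
   once the induced connection, the bracket and the curvature are known to map
   smooth fields to smooth fields, because h is only assumed to vanish on those;
   for (iv) take alpha = eta. *)
Require Import Defs.
From HB Require Import structures.
From mathcomp Require Import all_boot all_order all_algebra.
From mathcomp Require Import all_classical all_reals all_analysis.
From mathcomp Require Import ring.

Set Implicit Arguments.
Unset Strict Implicit.
Unset Printing Implicit Defensive.
Import Order.TTheory GRing.Theory Num.Theory.
Import numFieldNormedType.Exports.
Local Open Scope ring_scope.

(** The obstacle is that a tangent vector at [q] is a row read in [chart q], which need not depend
    continuously on [q]. Every smoothness claim and every derivative is therefore moved to one fixed
    chart, by [comps] on a manifold and by [scomps] along [f], and fields are expanded there in a
    coordinate frame. Moreover the Levi-Civita axioms speak of ambient fields, whereas h
    differentiates sections along [f]: the coordinate formula of [pullback] must first inherit the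
    Leibniz rule, smoothness and vanishing torsion. Torsion rests on the symmetry of second
    derivatives; it yields the symmetry of h, and with it tensoriality in the second slot. The test
    field xi is globally smooth, so no cutoff functions enter. The constant 2 in the curvature comes
    from tilde-R(X, xi) xi = - 2 X modulo xi: torsion-freeness merges - 2 nabla_xi X - 2 [X, xi]
    into - 2 nabla_X xi. Components along xi are left unspecified, as h kills them. *)

(** * Calculus of C^k maps between normed spaces *)

Section Ck_calculus.
Local Open Scope classical_set_scope.
Local Open Scope ring_scope.
Context {R : realType}.
Implicit Types U V W : normedModType R.

(** The first-order expansion of [F] at [x] is also one of [G], and [diff_unique] then identifies
    ['d F x] as the differential of [G]. *)
Lemma near_eq_differentiable V W (F G : V -> W) (x : V) :
  (\forall y \near x, F y = G y) -> differentiable F x -> differentiable G x.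
Proof.
move=> FG dF; have FGx := nbhs_singleton FG.
have EG : G \o shift x = cst (G x) + 'd F x +o_ 0 id.
  apply/eqaddoP => _/posnumP[e].
  have /eqaddoP/(_ _ (gt0 e)) := diff_locally dF.
  apply: filterS2; last by move: FG; rewrite (near_shift 0 x) subr0; exact.
  by move=> h FGh; rewrite !fctE /= FGh -FGx.
have dFc : continuous ('d F x) by exact: diff_continuous.
apply/diff_locallyP; rewrite (diff_unique dFc EG); split=> //.
Qed.

Lemma near_open V (A : set V) x : open A -> A x -> \forall y \near x, A y.
Proof. by move=> oA Ax; apply: open_nbhs_nbhs. Qed.

Lemma CkS k V W (A B : set V) (F : V -> W) : B `<=` A -> Ck k A F -> Ck k B F.
Proof.
move=> BA; elim: k F => [|k IH] F /=; first by move=> cF x /BA; exact: cF.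
by case=> dF cF; split=> [x /BA|v]; [exact: dF|exact: IH].
Qed.

(** Openness turns agreement on [A] into agreement near each of its points, which is what
    derivatives see. *)
Lemma eq_Ck k V W (A : set V) (F G : V -> W) : open A ->
  (forall x, A x -> F x = G x) -> Ck k A F -> Ck k A G.
Proof.
move=> oA; elim: k F G => [|k IH] F G FG.
  move=> cF x Ax; suff : G y @[y --> x] --> F x by rewrite FG.
  apply: cvg_trans (cF x Ax); apply: near_eq_cvg.
  by near do apply: FG; exact: near_open.
have nFG x : A x -> \forall y \near x, F y = G y.
  by move=> Ax; near do apply: FG; exact: near_open.
case=> dF cF; split=> [x Ax|v].
  by apply: near_eq_differentiable (nFG x Ax) _; exact: dF.
by apply: IH (cF v) => x Ax; apply: near_eq_derive; exact: nFG.
Unshelve. all: by end_near. Qed.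

Lemma CkW k V W (A : set V) (F : V -> W) : Ck k.+1 A F -> Ck k A F.
Proof.
elim: k F => [|k IH] F [dF cF].
  by move=> x Ax; apply: differentiable_continuous; exact: dF.
by split=> // v; apply: IH; exact: cF.
Qed.

Lemma Ck_cst k V W (A : set V) (w : W) : Ck k A (fun _ => w).
Proof.
elim: k w => [|k IH] w /=; first by move=> x _; exact: cvg_cst.
split=> [x _|v]; first exact: differentiable_cst.
rewrite [X in Ck _ _ X](_ : _ = fun=> 0) //.
by apply/funext => x; rewrite derive_cst.
Qed.

Lemma CkD k V W (A : set V) (F G : V -> W) : open A ->
  Ck k A F -> Ck k A G -> Ck k A (fun x => F x + G x).
Proof.
move=> oA; elim: k F G => [|k IH] F G.
  by move=> cF cG x Ax; apply: continuousD; [exact: cF|exact: cG].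
move=> [dF cF] [dG cG]; split=> [x Ax|v].
  by apply: differentiableD; [exact: dF|exact: dG].
apply: eq_Ck (IH _ _ (cF v) (cG v)) => // x Ax; apply/esym.
by apply: deriveD; apply: diff_derivable; [exact: dF|exact: dG].
Qed.

Lemma CkZl k V W (A : set V) (u : V -> R) (w : W) : open A ->
  Ck k A u -> Ck k A (fun x => u x *: w).
Proof.
move=> oA; elim: k u => [|k IH] u.
  by move=> cu x Ax; apply: cvgZr_tmp; exact: cu.
move=> [du cu]; split=> [x Ax|v].
  by apply: differentiableZl; exact: du.
apply: eq_Ck (IH _ (cu v)) => // x Ax; apply/esym.
have dux := du x Ax.
by rewrite !deriveE ?diffZl//; exact: differentiableZl.
Qed.

Lemma Ck_coord k V (b c : nat) (A : set V) (F : V -> 'M[R]_(b, c)) i j :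
  open A -> Ck k A F -> Ck k A (fun x => F x i j).
Proof.
move=> oA; elim: k F => [|k IH] F.
  move=> cF x Ax; apply: (@continuous_comp _ _ _ F (fun M => M i j)).
    exact: cF.
  exact: coord_continuous.
move=> [dF cF]; split=> [x Ax|v].
  apply: (@differentiable_comp _ _ _ _ F (fun M : 'M[R]_(b, c) => M i j)).
    exact: dF.
  exact: differentiable_coord.
apply: eq_Ck (IH _ (cF v)) => // x Ax.
rewrite derive_mx ?mxE//; exact/diff_derivable/dF.
Qed.

Lemma Ck_sum k V W (A : set V) (I : Type) (r : seq I) (P : pred I)
    (F : I -> V -> W) : open A -> (forall i, P i -> Ck k A (F i)) ->
  Ck k A (fun x => \sum_(i <- r | P i) F i x).
Proof.
move=> oA cF; elim: r => [|i r IH].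
  rewrite [X in Ck _ _ X](_ : _ = fun=> 0); first exact: Ck_cst.
  by apply/funext => x; rewrite big_nil.
under eq_fun do rewrite big_cons.
by have [/cF Fi|_] := boolP (P i); [exact: CkD|].
Qed.

Lemma CkM k V (A : set V) (u v : V -> R) : open A ->
  Ck k A u -> Ck k A v -> Ck k A (fun x => u x * v x).
Proof.
move=> oA; elim: k u v => [|k IH] u v.
  by move=> cu cv x Ax; apply: continuousM; [exact: cu|exact: cv].
move=> Cu Cv; have [[du cu] [dv cv]] := (Cu, Cv); split=> [x Ax|w].
  by apply: differentiableM; [exact: du|exact: dv].
apply: (@eq_Ck _ _ _ _ (fun x => u x * 'D_w v x + v x * 'D_w u x)) => //.
  move=> x Ax; apply/esym.
  by apply: deriveM; apply: diff_derivable; [exact: du|exact: dv].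
by apply: CkD => //; apply: IH; [exact: CkW|exact: cv|exact: CkW|exact: cu].
Qed.

(** The derivative of the inverse is a product of the inverse with itself and with ['D_w u], so
    order [k] of the inverse feeds its own order [k.+1]. *)
Lemma CkV k V (A : set V) (u : V -> R) : open A ->
  (forall x, A x -> u x != 0) -> Ck k A u -> Ck k A (fun x => (u x)^-1).
Proof.
move=> oA u0; elim: k => [|k IH].
  by move=> cu x Ax; apply: continuousV; [exact: u0|exact: cu].
move=> Cu; have [du cu] := Cu; split=> [x Ax|w].
  by apply: differentiableV; [exact: du|exact: u0].
pose v x := (u x)^-1.
apply: (@eq_Ck _ _ _ _ (fun x => -1 * (v x * (v x * 'D_w u x)))) => //.
  move=> x Ax; rewrite deriveV ?u0//; last exact/diff_derivable/du.
  by rewrite -[RHS]/(- (u x) ^- 2 * _) mulN1r mulrA mulNr -exprVn expr2.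
have Cv : Ck k A v by apply: IH; exact: CkW.
apply: (CkM oA); first exact: Ck_cst.
by apply: (CkM oA Cv); apply: (CkM oA Cv); exact: cu.
Qed.

Lemma derive_comp U V W (G : U -> V) (F : V -> W) x v :
  differentiable G x -> differentiable F (G x) ->
  'D_v (F \o G) x = 'D_('D_v G x) F (G x).
Proof.
move=> dG dF; rewrite deriveE; last exact: differentiable_comp.
by rewrite diff_comp //= !deriveE.
Qed.

Lemma derive_row b W (F : 'rV[R]_b -> W) x v : differentiable F x ->
  'D_v F x = \sum_j v 0 j *: 'D_(delta_mx 0 j) F x.
Proof.
move=> dF; rewrite deriveE// {1}[v]row_sum_delta linear_sum; apply: eq_bigr.
by move=> j _; rewrite linearZ deriveE.
Qed.

(** With a real-valued [u] on row vectors the chain rule is a finite sum of products of real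
    functions, each covered by [CkM] and the induction hypothesis. *)
Lemma Ck_comp k V (b : nat) (A : set V) (B : set 'rV[R]_b) (G : V -> 'rV[R]_b)
    (u : 'rV[R]_b -> R) : open A -> open B -> (forall x, A x -> B (G x)) ->
  Ck k A G -> Ck k B u -> Ck k A (u \o G).
Proof.
move=> oA oB AB; elim: k u => [|k IH] u.
  move=> cG cu x Ax; apply: continuous_comp; [exact: cG|exact/cu/AB].
move=> CG [du cu]; have [dG cG] := CG; split=> [x Ax|w].
  by apply: differentiable_comp; [exact: dG|exact/du/AB].
apply: (@eq_Ck _ _ _ _ (fun x =>
  \sum_j 'D_w G x 0 j * 'D_(delta_mx 0 j) u (G x))) => //.
  move=> x Ax; have duG := du _ (AB _ Ax).
  by rewrite (derive_comp _ (dG x Ax) duG) (derive_row _ duG).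
apply: Ck_sum => // j _; apply: CkM => //; first exact: Ck_coord (cG w).
by apply: (IH ('D_(delta_mx 0 j) u)); [exact: CkW|exact: cu].
Qed.

Lemma differentiable_shift V (a x : V) : differentiable (shift a) x.
Proof. exact: ex_diff. Qed.

Lemma derive_shift_comp V W (F : V -> W) (a x v : V) :
  'D_v (fun z => F (a + z)) x = 'D_v F (a + x).
Proof. by rewrite /derive /=; under eq_fun do rewrite addrCA. Qed.

Lemma MVT_line V (F : V -> R) (y v : V) (r : R) : 0 < r ->
  (forall s, s \in `[0, r] -> differentiable F (s *: v + y)) ->
  exists2 c, c \in `[0, r] & F (r *: v + y) - F y = r * 'D_v F (c *: v + y).
Proof.
move=> r0 dF; pose G (s : R) := s *: v + y.
have dZ s : is_diff s (fun z : R => z *: v) (fun z => z *: v).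
  exact: is_diff_scalel.
have dG s : differentiable G s.
  apply: (@differentiableD _ _ _ _ (cst y)).
    exact: (@ex_diff _ _ _ _ _ _ _ (dZ s)).
  exact: differentiable_cst.
have DG s : 'D_1 G s = v.
  rewrite deriveE//.
  rewrite (@diffD _ _ _ _ (cst y)); first last.
  - exact: differentiable_cst.
  - exact: (@ex_diff _ _ _ _ _ _ _ (dZ s)).
  by rewrite diff_cst /= [X in X + _]/= diff_val scale1r [X in _ + X]/= addr0.
have dFG s : s \in `[0, r] -> is_derive s (1 : R) (F \o G) ('D_v F (G s)).
  move=> sr; apply: DeriveDef.
    by apply/diff_derivable/differentiable_comp => //; exact: dF.
  by rewrite derive_comp ?DG//; exact: dF.
have dFGo s : s \in `]0, r[ -> is_derive s (1 : R) (F \o G) ('D_v F (G s)).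
  by rewrite in_itv/= => /andP[s0 sr]; apply: dFG; rewrite in_itv/= !ltW.
have cFG : {within `[0, r]%classic, continuous (F \o G)}.
  apply/continuous_in_subspaceT => s; rewrite inE => sr.
  by apply/differentiable_continuous/differentiable_comp => //; exact: dF.
have [c cr Hc] := MVT_segment (ltW r0) dFGo cFG.
exists c => //; move: Hc.
by rewrite /= /G scale0r add0r subr0 mulrC.
Qed.

(* Two applications of the mean value theorem, first in direction v, then in
   direction w. As the left-hand side is symmetric in v and w, letting r tend to
   0 gives the symmetry of second derivatives. *)
Lemma second_difference V (A : set V) (F : V -> R) (x v w : V) (r : R) :
  0 < r -> Ck 2 A F ->
  (forall s t, s \in `[0, r] -> t \in `[0, r] ->
     A (t *: w + (s *: v + x))) ->
  exists s t, [/\ s \in `[0, r], t \in `[0, r] &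
    F (r *: w + (r *: v + x)) - F (r *: v + x) - (F (r *: w + x) - F x) =
    r * (r * 'D_w ('D_v F) (t *: w + (s *: v + x)))].
Proof.
move=> r0 [dF /(_ v)[dvF _]] Ar.
have I0 : 0 \in `[0, r] by rewrite in_itv/= lexx ltW.
have Ir : r \in `[0, r] by rewrite in_itv/= lexx ltW.
have A0 s : s \in `[0, r] -> A (s *: v + x).
  by move=> sr; have := Ar s 0 sr I0; rewrite scale0r add0r.
have dsh s : s \in `[0, r] ->
    differentiable (fun z => F (r *: w + z)) (s *: v + x).
  move=> sr; rewrite (_ : (fun _ => _) = F \o shift (r *: w)); last first.
    by apply/funext => z; rewrite /= addrC.
  apply: differentiable_comp; first exact: differentiable_shift.
  by rewrite /= addrC; apply/dF/Ar.
have dH s : s \in `[0, r] ->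
    differentiable (fun z => F (r *: w + z) - F z) (s *: v + x).
  by move=> sr; apply: differentiableB; [exact: dsh|exact/dF/A0].
have [s sr Hs] := MVT_line r0 dH.
have [t tr Ht] := MVT_line r0 (fun t tr => dvF _ (Ar s t sr tr)).
exists s, t; split=> //; rewrite Hs deriveB ?derive_shift_comp ?Ht//.
- by apply/diff_derivable/dsh.
- by apply/diff_derivable/dF/A0.
Qed.

(** If the two mixed derivatives differed at [x], continuity would keep each within half the gap of
    its value at [x] on a small ball, while [second_difference], used in both orders, yields points
    of that ball where they are equal. *)
Lemma derive_commute V (A : set V) (F : V -> R) (x v w : V) : open A -> A x ->
  Ck 2 A F -> 'D_v ('D_w F) x = 'D_w ('D_v F) x.
Proof.
move=> oA Ax CF; have [_ cF] := CF.
have aux (a b c c' : R) :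
    `|a - c| < `|a - b| / 2 -> `|b - c'| < `|a - b| / 2 -> c = c' -> False.
  move=> ac bc cc'; suff : `|a - b| < `|a - b| by rewrite ltxx.
  rewrite -{1}(subrKA c) (le_lt_trans (ler_normD _ _))// [ltRHS]splitr.
  by rewrite ltrD// cc' distrC.
have cvw : {for x, continuous ('D_v ('D_w F))} by apply: (cF w).2.
have cwv : {for x, continuous ('D_w ('D_v F))} by apply: (cF v).2.
apply/eqP; rewrite -subr_eq0 -normr_le0 leNgt; apply/negP => d0.
set d := `|_| in d0.
have e0 : 0 < d / 2 by rewrite divr_gt0.
have n1 : \forall y \near x, `|'D_v ('D_w F) x - 'D_v ('D_w F) y| < d / 2.
  by move/cvgrPdist_lt : cvw => /(_ _ e0).
have n2 : \forall y \near x, `|'D_w ('D_v F) x - 'D_w ('D_v F) y| < d / 2.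
  by move/cvgrPdist_lt : cwv => /(_ _ e0).
have n3 : nbhs x [set y | A y /\ `|'D_v ('D_w F) x - 'D_v ('D_w F) y| < d / 2
    /\ `|'D_w ('D_v F) x - 'D_w ('D_v F) y| < d / 2].
  by apply: filterI (filterI n1 n2); exact: near_open.
have /nbhs_ballP[e /= epos He] := n3.
(* With [r = e / N] the parallelogram spanned at [x] by [r *: v] and [r *: w] stays inside the ball;
   the summand 1 keeps [N] positive when both vectors vanish. *)
pose N := `|v| + `|w| + 1.
have N0 : 0 < N by rewrite ltr_wpDl.
pose r := e / N.
have r0 : 0 < r by rewrite divr_gt0.
have Hr s t : s \in `[0, r] -> t \in `[0, r] ->
    ball x e (t *: w + (s *: v + x)).
  rewrite !in_itv/= => /andP[s0 sr] /andP[t0 tr].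
  rewrite -ball_normE /= addrA opprD addrCA subrr addr0 normrN.
  apply: le_lt_trans (ler_normD _ _) _; rewrite !normrZ !ger0_norm//.
  rewrite -[e](divfK (lt0r_neq0 N0)) -/r.
  apply: (@le_lt_trans _ _ (r * `|w| + r * `|v|)).
    by apply: lerD; apply: ler_wpM2r.
  by rewrite -mulrDr ltr_pM2l// addrC ltrDl.
have [s [t [sr tr Hst]]] :=
  second_difference r0 CF (fun s t sr tr => (He _ (Hr s t sr tr)).1).
have Hr' s' t' : s' \in `[0, r] -> t' \in `[0, r] ->
    ball x e (t' *: v + (s' *: w + x)).
  by move=> sr' tr'; rewrite addrCA; exact: Hr.
have [s' [t' [sr' tr' Hst']]] :=
  second_difference r0 CF (fun s t sr tr => (He _ (Hr' s t sr tr)).1).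
have E : 'D_v ('D_w F) (t' *: v + (s' *: w + x)) =
         'D_w ('D_v F) (t *: w + (s *: v + x)).
  apply: (mulfI (lt0r_neq0 r0)); apply: (mulfI (lt0r_neq0 r0)).
  apply: etrans (esym Hst') (etrans _ Hst).
  rewrite (addrCA (r *: v)) !opprB -!addrA; congr (_ + _).
  by rewrite addrCA [RHS]addrCA; congr (_ + _); exact: addrC.
have [_ [H1 _]] := He _ (Hr' _ _ sr' tr').
have [_ [_ H2]] := He _ (Hr _ _ sr tr).
exact: aux H1 H2 E.
Qed.

End Ck_calculus.

(** * Smooth functions on a manifold, read in charts *)

Section Manifold_calculus.
Local Open Scope classical_set_scope.
Local Open Scope ring_scope.
Context {R : realType} {n : nat} {M : manifold R n}.
Implicit Types (p q a : M) (W : normedModType R) (X Y : vfield M).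

Lemma near_chart p q (P : set 'rV[R]_n) : dom p q ->
  (\forall x \near chart p q, P x) -> \forall r \near q, P (chart p r).
Proof. by move=> pq; exact: (chart_continuous pq). Qed.

Lemma near_ichart p q (P : set M) : dom p q ->
  (\forall r \near q, P r) -> \forall x \near chart p q, P (ichart p x).
Proof.
move=> pq nP; have ex : (chart p @` dom p) (chart p q) by exists q.
by apply: (ichart_continuous ex); rewrite chartK.
Qed.

Lemma near_dom p q : dom p q -> \forall r \near q, dom p r.
Proof. by move=> pq; apply: open_nbhs_nbhs; split=> //; exact: dom_open. Qed.

Lemma near_codom p q : dom p q ->
  \forall x \near chart p q, (chart p @` dom p) x.
Proof.
move=> pq; apply: open_nbhs_nbhs; split; first exact: chart_open.
by exists q.
Qed.

Lemma ichartK p x : (chart p @` dom p) x -> chart p (ichart p x) = x.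
Proof. by case=> q pq <-; rewrite chartK. Qed.

Lemma dom_ichart p x : (chart p @` dom p) x -> dom p (ichart p x).
Proof. by case=> q pq <-; rewrite chartK. Qed.

Lemma open_chart p (B : set M) : open B -> open (chart p @` (dom p `&` B)).
Proof.
move=> oB; rewrite openE => x [q [pq Bq] <-].
have nB : \forall r \near q, B r by apply: open_nbhs_nbhs.
apply: filterS2 (near_codom pq) (near_ichart pq nB) => y cy By.
by exists (ichart p y); [split=> //; exact: dom_ichart|exact: ichartK].
Qed.

(** Side conditions arrive as neighbourhoods while [smooth_near] asks for an open set; this shrinks
    the one to the other. *)
Lemma near_smooth W (F : M -> W) p (A : set 'rV[R]_n) :
  (\forall x \near chart p p, A x) -> (forall B, open B -> B `<=` A ->
    smooth_on B (F \o ichart p)) -> smooth_near F p.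
Proof.
move=> nA h; have : nbhs (chart p p) A by exact: nA.
by rewrite nbhsE => -[B [oB Bp] BA]; exists B; split=> //; exact: h.
Qed.

Lemma smooth_on_sub (V W : normedModType R) (A B : set V) (F : V -> W) :
  B `<=` A -> smooth_on A F -> smooth_on B F.
Proof. by move=> BA sF k; exact: CkS (sF k). Qed.

Lemma eq_smooth_near W (F G : M -> W) p :
  (\forall q \near p, F q = G q) -> smooth_near F p -> smooth_near G p.
Proof.
move=> FG [A [oA Ap sF]].
apply: (@near_smooth _ _ _ (A `&` [set x | F (ichart p x) = G (ichart p x)])).
  by apply: filterI (near_ichart (dom_mem p) FG); exact: near_open oA Ap.
move=> B oB BA k; apply: (@eq_Ck _ _ _ _ _ (F \o ichart p)) => // [x /BA[]//|].
by apply: CkS (sF k) => x /BA[].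
Qed.

Lemma smooth_near_cst W (w : W) p : smooth_near (fun _ => w) p.
Proof. by exists setT; split=> // [|k]; [exact: openT|exact: Ck_cst]. Qed.

Lemma smooth_near2 W1 W2 W3 (F : M -> W1) (G : M -> W2) (H : M -> W3) p :
  (forall A, open A -> smooth_on A (F \o ichart p) ->
     smooth_on A (G \o ichart p) -> smooth_on A (H \o ichart p)) ->
  smooth_near F p -> smooth_near G p -> smooth_near H p.
Proof.
move=> h [A [oA Ap sF]] [B [oB Bp sG]]; exists (A `&` B).
have oAB := openI oA oB; split=> //; apply: h => //.
  by apply: smooth_on_sub sF => x [].
by apply: smooth_on_sub sG => x [].
Qed.

Lemma smooth_nearD W (F G : M -> W) p :
  smooth_near F p -> smooth_near G p -> smooth_near (fun q => F q + G q) p.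
Proof. by apply: smooth_near2 => A oA sF sG k; exact: CkD. Qed.

Lemma smooth_nearM (u v : M -> R) p :
  smooth_near u p -> smooth_near v p -> smooth_near (fun q => u q * v q : R) p.
Proof.
by apply: smooth_near2 => A oA sF sG k; apply: (CkM oA); [exact: sF|exact: sG].
Qed.

Lemma smooth_nearZl W (u : M -> R) (w : W) p :
  smooth_near u p -> smooth_near (fun q => u q *: w) p.
Proof.
by case=> A [oA Ap su]; exists A; split=> // k; apply: (CkZl w oA); exact: su.
Qed.

Lemma smooth_near_coord b c (F : M -> 'M[R]_(b, c)) p i j :
  smooth_near F p -> smooth_near (fun q => F q i j : R) p.
Proof.
by case=> A [oA Ap su]; exists A; split=> // k; apply: (Ck_coord i j oA (su k)).
Qed.

Lemma smooth_near_sum W (I : Type) (r : seq I) (P : pred I) (F : I -> M -> W) p :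
  (forall i, P i -> smooth_near (F i) p) ->
  smooth_near (fun q => \sum_(i <- r | P i) F i q) p.
Proof.
move=> sF; elim: r => [|i r IH].
  by under eq_fun do rewrite big_nil; exact: smooth_near_cst.
under eq_fun do rewrite big_cons.
by have [/sF Fi|_] := boolP (P i); [exact: smooth_nearD|].
Qed.

Lemma smooth_near_prod (I : Type) (r : seq I) (F : I -> M -> R) p :
  (forall i, smooth_near (F i) p) ->
  smooth_near (fun q => \prod_(i <- r) F i q : R) p.
Proof.
move=> sF; elim: r => [|i r IH].
  by under eq_fun do rewrite big_nil; exact: smooth_near_cst.
by under eq_fun do rewrite big_cons; exact: smooth_nearM.
Qed.

Lemma smooth_near_row b (F : M -> 'rV[R]_b) p :
  (forall j, smooth_near (fun q => F q 0 j : R) p) -> smooth_near F p.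
Proof.
move=> sF; rewrite (_ : F = fun q => \sum_j F q 0 j *: delta_mx 0 j).
  by apply: smooth_near_sum => j _; exact: smooth_nearZl.
by apply/funext => q; rewrite -row_sum_delta.
Qed.

Lemma smooth_nearZ b (u : M -> R) (F : M -> 'rV[R]_b) p :
  smooth_near u p -> smooth_near F p -> smooth_near (fun q => u q *: F q) p.
Proof.
move=> su sF; apply: smooth_near_row => j; under eq_fun do rewrite mxE.
by apply: smooth_nearM => //; exact: smooth_near_coord.
Qed.

Lemma smooth_near_differentiable W (F : M -> W) p :
  smooth_near F p -> differentiable (F \o ichart p) (chart p p).
Proof. by case=> A [_ Ap /(_ 1)[dF _]]; exact: dF. Qed.

Lemma smooth_near_continuous W (F : M -> W) p :
  smooth_near F p -> {for p, continuous F}.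
Proof.
move=> /smooth_near_differentiable/differentiable_continuous cF.
have pp := dom_mem p; suff : F q @[q --> p] --> F p by [].
rewrite -{2}(chartK pp); move=> P /cF /(near_chart pp).
by apply: filterS2 (near_dom pp) => q pq /=; rewrite chartK.
Qed.

Lemma smooth_nearV (u : M -> R) p : u p != 0 ->
  smooth_near u p -> smooth_near (fun q => (u q)^-1 : R) p.
Proof.
move=> u0 su; have [A [oA Ap sA]] := su; have pp := dom_mem p.
have nu : \forall q \near p, u q != 0.
  have /cvgr_neq0 : u q @[q --> p] --> u p by exact: smooth_near_continuous.
  exact.
apply: (@near_smooth _ _ _ (A `&` [set x | u (ichart p x) != 0])).
  by apply: filterI (near_ichart pp nu); exact: near_open oA Ap.
move=> B oB BA k; apply: CkV => // [x /BA[]//|].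
by apply: CkS (sA k) => x /BA[].
Qed.

Lemma smooth_near_comp b (G : M -> 'rV[R]_b) (B : set 'rV[R]_b)
    (u : 'rV[R]_b -> R) p : open B -> B (G p) -> smooth_near G p ->
  smooth_on B u -> smooth_near (u \o G : M -> R) p.
Proof.
move=> oB BGp sG su; have [A [oA Ap sA]] := sG; have pp := dom_mem p.
have nG : \forall q \near p, B (G q).
  by apply: (smooth_near_continuous sG); exact: near_open oB BGp.
apply: (@near_smooth _ _ _ (A `&` [set x | B (G (ichart p x))])).
  by apply: filterI (near_ichart pp nG); exact: near_open oA Ap.
move=> C oC CA k; apply: (Ck_comp oC oB _ _ (su k)) => [x /CA[]//|].
by apply: CkS (sA k) => x /CA[].
Qed.

Lemma smooth_near_chart p q : dom p q -> smooth_near (chart p) q.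
Proof.
move=> pq; exists (chart q @` (dom q `&` dom p)); split.
- exact/open_chart/dom_open.
- by exists q => //; split=> //; exact: dom_mem.
- exact: transition_smooth.
Qed.

(** Smoothness at [q] is measured in the chart of [q], so [F] is written as its expression in the
    chart of [p] after [chart p], which is smooth at [q] because transition maps are. *)
Lemma smooth_near_near b (F : M -> 'rV[R]_b) p : smooth_near F p ->
  \forall q \near p, smooth_near F q.
Proof.
case=> A [oA Ap sA]; have pp := dom_mem p.
have nA : \forall q \near p, A (chart p q).
  by apply: (near_chart pp); exact: near_open oA Ap.
apply: filterS2 nA (near_dom pp) => q Aq pq; apply: smooth_near_row => j.
apply: (@eq_smooth_near _ ((fun x => F (ichart p x) 0 j) \o chart p)).
  by apply: filterS (near_dom pq) => r pr /=; rewrite chartK.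
apply: (smooth_near_comp oA) => //; first exact: smooth_near_chart.
by move=> k; exact: Ck_coord (sA k).
Qed.

Lemma smooth_near_near_real (u : M -> R) p : smooth_near u p ->
  \forall q \near p, smooth_near u q.
Proof.
move=> su; have : smooth_near (fun q => u q *: (delta_mx 0 0 : 'rV[R]_1)) p.
  exact: smooth_nearZl.
move/smooth_near_near; apply: filterS => q /(smooth_near_coord 0 0).
by under eq_fun do rewrite !mxE mulr1.
Qed.

End Manifold_calculus.

(** * Directional derivatives, coordinate fields and brackets *)

Section Directional_derivative.
Local Open Scope classical_set_scope.
Local Open Scope ring_scope.
Context {R : realType} {n : nat} {M : manifold R n}.
Implicit Types (p q a : M) (W : normedModType R) (X Y : vfield M).

Lemma eq_dirD W (F G : M -> W) p v :
  (\forall q \near p, F q = G q) -> dirD F p v = dirD G p v.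
Proof.
by move=> FG; apply: near_eq_derive; exact: near_ichart (dom_mem p) FG.
Qed.

Lemma dirD_cst W (w : W) p v : dirD (fun _ => w) p v = 0.
Proof. exact: derive_cst. Qed.

Lemma dirD0 W (F : M -> W) p : dirD F p 0 = 0.
Proof. exact: derive0. Qed.

Lemma dirDD W (F G : M -> W) p v : smooth_near F p -> smooth_near G p ->
  dirD (fun q => F q + G q) p v = dirD F p v + dirD G p v.
Proof.
move=> /smooth_near_differentiable dF /smooth_near_differentiable dG.
exact: deriveD (diff_derivable dF) (diff_derivable dG).
Qed.

Lemma dirDM (u w : M -> R) p v : smooth_near u p -> smooth_near w p ->
  dirD (fun q => u q * w q : R) p v = dirD u p v * w p + u p * dirD w p v.
Proof.
move=> /smooth_near_differentiable du /smooth_near_differentiable dw.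
have := deriveM (diff_derivable (v := v) du) (diff_derivable (v := v) dw).
rewrite /= (chartK (dom_mem p)) => h.
by apply: etrans h _; rewrite addrC [dirD u p v * _]mulrC.
Qed.

Lemma dirD_coord b (F : M -> 'rV[R]_b) p v j : smooth_near F p ->
  dirD F p v 0 j = dirD (fun q => F q 0 j : R) p v.
Proof.
move=> /smooth_near_differentiable dF.
by rewrite /dirD derive_mx ?mxE//; exact: diff_derivable.
Qed.

Lemma dirDZ b (u : M -> R) (F : M -> 'rV[R]_b) p v :
  smooth_near u p -> smooth_near F p ->
  dirD (fun q => u q *: F q) p v = dirD u p v *: F p + u p *: dirD F p v.
Proof.
move=> su sF; apply/rowP => j; rewrite !mxE !dirD_coord//.
  under eq_fun do rewrite mxE.
  by rewrite dirDM//; exact: smooth_near_coord.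
exact: smooth_nearZ.
Qed.

Lemma dirD_linear W (F : M -> W) p : smooth_near F p -> linear (dirD F p).
Proof.
by move=> /smooth_near_differentiable dF c v w; rewrite /dirD !deriveE// linearP.
Qed.

Lemma dirDBv W (F : M -> W) p v w : smooth_near F p ->
  dirD F p (v - w) = dirD F p v - dirD F p w.
Proof.
move=> sF; have := dirD_linear sF (-1) w v.
by rewrite !scaleN1r ![- _ + _]addrC.
Qed.

Lemma dirD_chart_id p v : dirD (chart p) p v = v.
Proof.
rewrite -[RHS](derive_id (chart p p) v); apply: near_eq_derive.
by apply: filterS (near_codom (dom_mem p)) => x; exact: ichartK.
Qed.

(** The chain rule through the transition map [chart p \o ichart q]: derivatives at all [q] near [p]
    become readable in the single chart of [p]. *)
Lemma dirD_chart W (F : M -> W) p q v : dom p q ->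
  differentiable (F \o ichart p) (chart p q) ->
  dirD F q v = 'D_(dirD (chart p) q v) (F \o ichart p) (chart p q).
Proof.
move=> pq dF; have qq := dom_mem q.
have dT := smooth_near_differentiable (smooth_near_chart pq).
have Eq : (chart p \o ichart q) (chart q q) = chart p q by rewrite /= chartK.
rewrite -[in RHS]Eq /dirD -(derive_comp _ dT); last by rewrite Eq.
apply: near_eq_derive; apply: filterS (near_ichart qq (near_dom pq)) => x px.
by rewrite /= chartK.
Qed.

Lemma differentiable_chart W (F : M -> W) p q : dom p q ->
  smooth_near F q -> differentiable (F \o ichart p) (chart p q).
Proof.
move=> pq sF; have qq := dom_mem q.
apply: (@near_eq_differentiable _ _ _
    ((F \o ichart q) \o (chart q \o ichart p))).
  apply: filterS (near_ichart pq (near_dom qq)) => x qx /=.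
  by rewrite chartK.
apply: differentiable_comp; last first.
  by rewrite /= chartK//; exact: smooth_near_differentiable.
have := @transition_smooth _ _ M p q 1%N; case=> dT _; apply: dT.
by exists q.
Qed.

(** The Jacobians of the two transition maps between the charts of [a] and [q] are mutually inverse;
    [comps_coord_field] is the composition in the other order. *)
Lemma coord_fieldK a q v : dom a q ->
  coord_field a (dirD (chart a) q v) q = v.
Proof.
move=> aq; rewrite /coord_field -dirD_chart ?dirD_chart_id//.
exact: differentiable_chart (smooth_near_chart (dom_mem q)).
Qed.

Lemma comps_coord_field a q w : dom a q ->
  comps a (coord_field a w) q = w.
Proof.
move=> aq; have qq := dom_mem q.
have Eq : (chart q \o ichart a) (chart a q) = chart q q by rewrite /= chartK.
have dq := differentiable_chart aq (smooth_near_chart qq).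
have da := smooth_near_differentiable (smooth_near_chart aq).
rewrite /comps /dirD /coord_field -[in LHS]Eq -(derive_comp _ dq) ?Eq//.
rewrite -[RHS](derive_id (chart a q) w); apply: near_eq_derive.
apply: filterS2 (near_ichart aq (near_dom qq)) (near_codom aq) => x qx ax.
by rewrite /= chartK// ichartK.
Qed.

Lemma coord_field_linear a q : dom a q -> linear (fun w => coord_field a w q).
Proof.
move=> aq c v w; rewrite /coord_field.
have dq := differentiable_chart aq (smooth_near_chart (dom_mem q)).
by rewrite !deriveE// linearP.
Qed.

Lemma coord_field_id a w : coord_field a w a = w.
Proof.
by rewrite -[RHS](comps_coord_field w (dom_mem a)) /comps dirD_chart_id.
Qed.

Lemma comps_id p X : comps p X p = X p.
Proof. exact: dirD_chart_id. Qed.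

Lemma coord_field_sum a q w : dom a q ->
  coord_field a w q = \sum_j w 0 j *: coord_field a (delta_mx 0 j) q.
Proof.
move=> aq; rewrite /coord_field derive_row//.
exact: differentiable_chart (smooth_near_chart (dom_mem q)).
Qed.

Lemma coord_field_expand a q v : dom a q ->
  v = \sum_j dirD (chart a) q v 0 j *: coord_field a (delta_mx 0 j) q.
Proof. by move=> aq; rewrite -coord_field_sum// coord_fieldK. Qed.

Lemma smooth_coord_field a q w : dom a q -> smooth_vf_near (coord_field a w) q.
Proof.
move=> aq; rewrite /smooth_vf_near; have qq := dom_mem q.
pose B := chart a @` (dom a `&` dom q).
have sT := @transition_smooth _ _ M a q.
(* Near [q] the components in the chart of [q] are a column of the Jacobian of a transition map,
   contracted with the constant [w]. *)
apply: (@eq_smooth_near _ _ M _ (fun r => 'D_w (chart q \o ichart a) (chart a r))).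
  apply: filterS2 (near_dom aq) (near_dom qq) => r ar qr.
  rewrite /comps (@dirD_chart _ (chart q) a r _ ar).
    by rewrite -[dirD (chart a) r _]/(comps a (coord_field a w) r) comps_coord_field.
  exact: differentiable_chart (smooth_near_chart qr).
apply: smooth_near_row => j.
apply: (@smooth_near_comp _ _ M _ (chart a) B
  (fun x => 'D_w (chart q \o ichart a) x 0 j)).
- exact/open_chart/dom_open.
- by exists q.
- exact: smooth_near_chart.
- move=> k; apply: (Ck_coord 0 j); first exact/open_chart/dom_open.
  by have [_] := sT k.+1; apply.
Qed.

Lemma smooth_vfD X Y p : smooth_vf_near X p -> smooth_vf_near Y p ->
  smooth_vf_near (fun q => X q + Y q) p.
Proof.
move=> sX sY; apply: eq_smooth_near (smooth_nearD sX sY).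
apply: filterS (near_dom (dom_mem p)) => q pq.
have := dirD_linear (smooth_near_chart pq) 1 (X q) (Y q).
by rewrite !scale1r => <-.
Qed.

Lemma smooth_vf_cst0 p : smooth_vf_near (fun _ : M => 0) p.
Proof.
apply: eq_smooth_near (smooth_near_cst 0 p).
by apply: filterE => q; rewrite /comps dirD0.
Qed.

Lemma smooth_vfZ (u : M -> R) X p : smooth_near u p -> smooth_vf_near X p ->
  smooth_vf_near (fun q => u q *: X q) p.
Proof.
move=> su sX; apply: eq_smooth_near (smooth_nearZ su sX).
apply: filterS (near_dom (dom_mem p)) => q pq.
have := dirD_linear (smooth_near_chart pq) (u q) (X q) 0.
by rewrite /comps dirD0 !addr0 => <-.
Qed.

Lemma eq_smooth_vf X Y p : (\forall q \near p, X q = Y q) ->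
  smooth_vf_near X p -> smooth_vf_near Y p.
Proof.
by move=> XY; apply: eq_smooth_near; apply: filterS XY => q; rewrite /comps => ->.
Qed.

Lemma smooth_vf_sum (I : Type) (r : seq I) (F : I -> vfield M) p :
  (forall i, smooth_vf_near (F i) p) ->
  smooth_vf_near (fun q => \sum_(i <- r) F i q) p.
Proof.
move=> sF; elim: r => [|i r IH].
  by under eq_fun do rewrite big_nil; exact: smooth_vf_cst0.
under eq_fun do rewrite big_cons.
exact: (@smooth_vfD (F i) (fun q => \sum_(j <- r) F j q) p (sF i) IH).
Qed.

Lemma vf_expand X p : \forall q \near p,
  \sum_j comps p X q 0 j *: coord_field p (delta_mx 0 j) q = X q.
Proof.
by apply: filterS (near_dom (dom_mem p)) => q pq; rewrite -coord_field_expand.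
Qed.

(** In the fixed chart of [p] this is the sum of X^j times the j-th partial derivative of [u], all
    factors being smooth. *)
Lemma smooth_dirD (u : M -> R) X p : smooth_near u p -> smooth_vf_near X p ->
  smooth_near (fun q => dirD u q (X q) : R) p.
Proof.
move=> su sX; have pp := dom_mem p; have [A [oA Ap sA]] := su.
apply: (@eq_smooth_near _ _ M _ (fun q => \sum_j comps p X q 0 j *
    'D_(delta_mx 0 j) (u \o ichart p) (chart p q))).
  apply: filterS2 (near_dom pp) (smooth_near_near_real su) => q pq sq.
  have d := differentiable_chart pq sq.
  by rewrite (dirD_chart _ pq d) (derive_row _ d).
apply: smooth_near_sum => j _; apply: smooth_nearM.
  exact: smooth_near_coord.
apply: (@smooth_near_comp _ _ M _ (chart p) A
  ('D_(delta_mx 0 j) (u \o ichart p)) _ oA Ap (smooth_near_chart pp)) => k.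
by have [_] := sA k.+1; apply.
Qed.

Lemma dirD_sum W (I : Type) (r : seq I) (F : I -> M -> W) p v :
  (forall i, smooth_near (F i) p) ->
  dirD (fun q => \sum_(i <- r) F i q) p v = \sum_(i <- r) dirD (F i) p v.
Proof.
move=> sF; elim: r => [|i r IH].
  by under eq_fun do rewrite big_nil; rewrite big_nil dirD_cst.
under eq_fun do rewrite big_cons; rewrite big_cons -IH.
by apply: dirDD => //; exact: smooth_near_sum.
Qed.

(* The last term is the Hessian in the coordinates of [chart p]. *)
Lemma dirD_dirD (u : M -> R) Y p v : smooth_near u p -> smooth_vf_near Y p ->
  dirD (fun q => dirD u q (Y q) : R) p v =
  dirD u p (dirD (comps p Y) p v) +
  'D_(Y p) ('D_v (u \o ichart p)) (chart p p).
Proof.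
move=> su sY; have pp := dom_mem p; have [A [oA Ap sA]] := su.
pose D (j : 'I_n) q : R := 'D_(delta_mx 0 j) (u \o ichart p) (chart p q).
have sD j : smooth_near (D j) p.
  apply: (@smooth_near_comp _ _ M _ (chart p) A
    ('D_(delta_mx 0 j) (u \o ichart p)) _ oA Ap (smooth_near_chart pp)) => k.
  by have [_] := sA k.+1; apply.
have sYj j : smooth_near (fun q => comps p Y q 0 j : R) p.
  exact: smooth_near_coord.
have nE : \forall q \near p, dirD u q (Y q) = \sum_j comps p Y q 0 j * D j q.
  apply: filterS2 (near_dom pp) (smooth_near_near_real su) => q pq sq.
  have d := differentiable_chart pq sq.
  by rewrite (dirD_chart _ pq d) (derive_row _ d).
rewrite (eq_dirD v nE) dirD_sum; last by move=> j; exact: smooth_nearM.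
under eq_bigr => j _ do rewrite (dirDM v (sYj j) (sD j)).
rewrite big_split /=; congr (_ + _).
  have d := smooth_near_differentiable su.
  rewrite [RHS](derive_row _ d); apply: eq_bigr => j _.
  by rewrite (dirD_coord v j sY).
have d : differentiable ('D_v (u \o ichart p)) (chart p p).
  by have [_ /(_ v)[dD _]] := sA 2; exact: dD.
have eD j : dirD (D j) p v =
    'D_(delta_mx 0 j) ('D_v (u \o ichart p)) (chart p p).
  (* Commuting the derivatives puts the direction [delta_mx 0 j] outside, so that the sum over [j]
     collapses to the direction [Y p]. *)
  rewrite -(derive_commute v (delta_mx 0 j) oA Ap (sA 2)); apply: near_eq_derive.
  by apply: filterS (near_codom pp) => x cx; rewrite /= /D ichartK.
apply: etrans _ (esym (derive_row _ d)); apply: eq_bigr => j _.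
by rewrite (eD j) (comps_id p Y).
Qed.

(** The Hessian terms of [dirD_dirD] cancel by [derive_commute]; what remains is the coordinate
    formula defining [bracket]. *)
Lemma dirD_bracket (u : M -> R) X Y p : smooth_near u p ->
  smooth_vf_near X p -> smooth_vf_near Y p ->
  dirD (fun q => dirD u q (Y q) : R) p (X p) -
  dirD (fun q => dirD u q (X q) : R) p (Y p) = dirD u p (bracket X Y p).
Proof.
move=> su sX sY; rewrite !dirD_dirD//.
have [A [oA Ap sA]] := su.
have aux (a b s t : R) : s = t -> a + s - (b + t) = a - b.
  by move=> ->; rewrite opprD addrACA subrr addr0.
apply: etrans (aux _ _ _ _ (derive_commute (Y p) (X p) oA Ap (sA 2))) _.
by rewrite dirDBv.
Qed.

End Directional_derivative.

(** * Connections in coordinates *)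

Section Connection.
Local Open Scope classical_set_scope.
Local Open Scope ring_scope.
Context {R : realType} {n : nat} {M : manifold R n}.
Variables (nb : conn M) (hnb : connection nb).
Implicit Types (p q a : M) (X Y : vfield M).

Lemma nbZ p v c Y : smooth_vf_near Y p ->
  nb p v (fun q => c *: Y q) = c *: nb p v Y.
Proof.
move=> sY; rewrite (conn_leibniz hnb v (smooth_near_cst c p) sY).
by rewrite dirD_cst scale0r add0r.
Qed.

Lemma nb0 p v : nb p v (fun _ => 0) = 0.
Proof.
have := nbZ v 0 (smooth_vf_cst0 p).
by rewrite !scale0r.
Qed.

Lemma nb_sum (I : Type) (r : seq I) (F : I -> vfield M) p v :
  (forall i, smooth_vf_near (F i) p) ->
  nb p v (fun q => \sum_(i <- r) F i q) = \sum_(i <- r) nb p v (F i).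
Proof.
move=> sF; elim: r => [|i r IH].
  by under eq_fun do rewrite big_nil; rewrite big_nil nb0.
under eq_fun do rewrite big_cons.
rewrite big_cons -IH; apply: (conn_add hnb) => //.
exact: smooth_vf_sum.
Qed.

(** Coordinate fields are linear in their constant components, hence so is the Christoffel term of
    [pullback] in the value of the section. *)
Lemma nb_coordD a u v w : nb a u (coord_field a (v + w)) =
  nb a u (coord_field a v) + nb a u (coord_field a w).
Proof.
have aa := dom_mem a; rewrite -(conn_add hnb); try exact: smooth_coord_field.
apply: (conn_local hnb); first exact: smooth_coord_field.
apply: filterS (near_dom aa) => q aq.
by have := coord_field_linear aq 1 v w; rewrite !scale1r.
Qed.

Lemma nb_coordZ a u c w : nb a u (coord_field a (c *: w)) =
  c *: nb a u (coord_field a w).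
Proof.
have aa := dom_mem a; rewrite -nbZ; try exact: smooth_coord_field.
apply: (conn_local hnb); first exact: smooth_coord_field.
apply: filterS (near_dom aa) => q aq.
have := coord_field_linear aq c w 0.
by rewrite !addr0 => ->; rewrite [X in _ + X]/coord_field derive0 addr0.
Qed.

Lemma nb_coord_sum a u (I : Type) (r : seq I) (w : I -> 'rV[R]_n) :
  nb a u (coord_field a (\sum_(i <- r) w i)) =
  \sum_(i <- r) nb a u (coord_field a (w i)).
Proof.
elim: r => [|i r IH].
  by rewrite !big_nil -[X in coord_field a X](scale0r 0) nb_coordZ scale0r.
rewrite !big_cons; apply: etrans (nb_coordD a u _ _) _.
by congr (_ + _).
Qed.

(** The Leibniz rule on the expansion of [Y] in the coordinate frame separates the derivative of the
    components from the Christoffel term. This is the shape in which [pullback] is defined, so it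
    ties the two together. *)
Lemma nbE a u Y : smooth_vf_near Y a ->
  nb a u Y = dirD (comps a Y) a u + nb a u (coord_field a (Y a)).
Proof.
move=> sY; have aa := dom_mem a.
have se j := smooth_coord_field (delta_mx 0 j) aa.
have sYj j : smooth_near (fun q => comps a Y q 0 j : R) a.
  exact: smooth_near_coord.
have sYe j : smooth_vf_near
    (fun q => comps a Y q 0 j *: coord_field a (delta_mx 0 j) q) a.
  exact: (smooth_vfZ (sYj j) (se j)).
have := conn_local hnb u (smooth_vf_sum (index_enum 'I_n) sYe) (vf_expand Y a).
move=> <-; rewrite nb_sum//.
under eq_bigr => j _ do rewrite (conn_leibniz hnb u (sYj j) (se j)).
rewrite big_split /=; congr (_ + _).
  rewrite [RHS]row_sum_delta; apply: eq_bigr => j _.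
  by rewrite coord_field_id dirD_coord.
pose w j : 'rV[R]_n := comps a Y a 0 j *: delta_mx 0 j.
have Ew : Y a = \sum_j w j by rewrite -[LHS](comps_id a Y) [LHS]row_sum_delta.
apply: etrans (_ : nb a u (coord_field a (\sum_j w j)) = _); last by rewrite Ew.
apply: etrans (esym (nb_coord_sum a u _ w)); apply: eq_bigr => j _.
exact: esym (nb_coordZ a u (comps a Y a 0 j) (delta_mx 0 j)).
Qed.

End Connection.

(** * Smooth sections along the immersion *)

Section Sections_along_immersion.
Local Open Scope classical_set_scope.
Local Open Scope ring_scope.
Context {R : realType} {m N : nat} {M : manifold R m} {Mb : manifold R N}.
Variables (f : M -> Mb) (hf : immersion f).
Implicit Types (p q : M) (X Y : vfield M) (V : M -> 'rV[R]_N).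

(* Components of the vector field V along f in the single chart [chart (f p)]. *)
Definition scomps p V q := dirD (chart (f p)) (f q) (V q).

Definition smooth_sec V p := smooth_near (scomps p V) p.

Lemma near_imm p (P : set Mb) :
  (\forall r \near f p, P r) -> \forall q \near p, P (f q).
Proof. by move=> nP; exact: (imm_continuous hf nP). Qed.

Lemma near_imm_dom p : \forall q \near p, dom (f p) (f q).
Proof. by apply: near_imm; exact: near_dom (dom_mem _). Qed.

Lemma smooth_near_imm (u : Mb -> R) p : smooth_near u (f p) ->
  smooth_near (fun q => u (f q) : R) p.
Proof.
case=> A [oA Ap sA].
have := @smooth_near_comp _ _ M _ (fun q => chart (f p) (f q)) A _ p oA Ap
  (imm_smooth hf p) sA.
apply: (@eq_smooth_near _ _ M _ _ (fun q => u (f q))).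
by apply: filterS (near_imm_dom p) => q pq /=; rewrite chartK.
Qed.

Lemma smooth_near_imm_row b (F : Mb -> 'rV[R]_b) p : smooth_near F (f p) ->
  smooth_near (fun q => F (f q)) p.
Proof.
move=> sF; apply: smooth_near_row => j.
exact: (@smooth_near_imm (fun r => F r 0 j) p (smooth_near_coord 0 j sF)).
Qed.

Lemma dirD_imm (W : normedModType R) (F : Mb -> W) p v : smooth_near F (f p) ->
  dirD (fun q => F (f q)) p v = dirD F (f p) (tmap f p v).
Proof.
move=> /smooth_near_differentiable dF; have pp := dom_mem p.
have dG := smooth_near_differentiable (imm_smooth hf p).
have Ep : ((fun q => chart (f p) (f q)) \o ichart p) (chart p p) =
    chart (f p) (f p) by rewrite /= chartK.
rewrite /tmap /dirD -[in RHS]Ep -(derive_comp _ dG) ?Ep//.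
apply: near_eq_derive; apply: filterS (near_ichart pp (near_imm_dom p)) => x px.
by rewrite /= chartK.
Qed.

Lemma tmap_linear p : linear (tmap f p).
Proof. exact/dirD_linear/imm_smooth. Qed.

Lemma tmapD p v w : tmap f p (v + w) = tmap f p v + tmap f p w.
Proof. by have := tmap_linear p 1 v w; rewrite !scale1r. Qed.

Lemma tmap0 p : tmap f p 0 = 0.
Proof. exact: dirD0. Qed.

Lemma tmapZ p c v : tmap f p (c *: v) = c *: tmap f p v.
Proof. by have := tmap_linear p c v 0; rewrite tmap0 !addr0. Qed.

Lemma tmapB p v w : tmap f p (v - w) = tmap f p v - tmap f p w.
Proof. exact: dirDBv (imm_smooth hf p). Qed.

Lemma sec_expand V p : \forall q \near p,
  \sum_j scomps p V q 0 j *: coord_field (f p) (delta_mx 0 j) (f q) = V q.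
Proof.
by apply: filterS (near_imm_dom p) => q pq; rewrite -coord_field_expand.
Qed.

Lemma scomps_id V p : scomps p V p = V p.
Proof. exact: dirD_chart_id. Qed.

Lemma smooth_sec_imm (Z : vfield Mb) p : smooth_vf_near Z (f p) ->
  smooth_sec (fun q => Z (f q)) p.
Proof. exact: smooth_near_imm_row. Qed.

Lemma eq_smooth_sec V V' p : (\forall q \near p, V q = V' q) ->
  smooth_sec V p -> smooth_sec V' p.
Proof.
by move=> VV; apply: eq_smooth_near; apply: filterS VV => q; rewrite /scomps => ->.
Qed.

Lemma scompsD V V' p : \forall q \near p,
  scomps p V q + scomps p V' q = scomps p (fun q => V q + V' q) q.
Proof.
apply: filterS (near_imm_dom p) => q pq.
have := dirD_linear (smooth_near_chart pq) 1 (V q) (V' q).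
by rewrite !scale1r => <-.
Qed.

Lemma scompsZ (u : M -> R) V p : \forall q \near p,
  u q *: scomps p V q = scomps p (fun q => u q *: V q) q.
Proof.
apply: filterS (near_imm_dom p) => q pq.
have := dirD_linear (smooth_near_chart pq) (u q) (V q) 0.
by rewrite dirD0 !addr0 => <-.
Qed.

Lemma smooth_secD V V' p : smooth_sec V p -> smooth_sec V' p ->
  smooth_sec (fun q => V q + V' q) p.
Proof.
by move=> sV sV'; exact: eq_smooth_near (scompsD V V' p) (smooth_nearD sV sV').
Qed.

Lemma smooth_secZ (u : M -> R) V p : smooth_near u p -> smooth_sec V p ->
  smooth_sec (fun q => u q *: V q) p.
Proof.
by move=> su sV; exact: eq_smooth_near (scompsZ u V p) (smooth_nearZ su sV).
Qed.

Lemma smooth_sec0 p : smooth_sec (fun _ => 0) p.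
Proof.
apply: eq_smooth_near (smooth_near_cst 0 p).
by apply: filterE => q; rewrite /scomps dirD0.
Qed.

Lemma smooth_sec_sum (I : Type) (r : seq I) (F : I -> M -> 'rV[R]_N) p :
  (forall i, smooth_sec (F i) p) ->
  smooth_sec (fun q => \sum_(i <- r) F i q) p.
Proof.
move=> sF; elim: r => [|i r IH].
  by under eq_fun do rewrite big_nil; exact: smooth_sec0.
under eq_fun do rewrite big_cons.
exact: (@smooth_secD (F i) (fun q => \sum_(j <- r) F j q) p (sF i) IH).
Qed.

(** The components of df(X) are the derivatives X(f^j) of the coordinates of [f], so [smooth_dirD]
    applies. *)
Lemma smooth_sec_push X p : smooth_vf_near X p -> smooth_sec (push f X) p.
Proof.
move=> sX; apply: smooth_near_row => j.
have sF := imm_smooth hf p.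
apply: eq_smooth_near (smooth_dirD (smooth_near_coord 0 j sF) sX).
apply: filterS2 (near_imm_dom p) (smooth_near_near sF) => q pq sq.
apply: etrans (esym (dirD_coord _ j sq)) _; congr (fun_of_matrix _ 0 j).
exact: dirD_imm (smooth_near_chart pq).
Qed.

End Sections_along_immersion.

(** * The pullback connection: Leibniz rule, smoothness, torsion *)

Section Pullback_connection.
Local Open Scope classical_set_scope.
Local Open Scope ring_scope.
Context {R : realType} {m N : nat} {M : manifold R m} {Mb : manifold R N}.
Variables (f : M -> Mb) (hf : immersion f) (nb : conn Mb) (hnb : connection nb).
Implicit Types (p q : M) (X Y : vfield M) (V : M -> 'rV[R]_N).

Lemma eq_pullback V V' p v : (\forall q \near p, V q = V' q) ->
  pullback f nb p v V = pullback f nb p v V'.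
Proof.
move=> VV; have VVp : V p = V' p by exact: nbhs_singleton VV.
rewrite /pullback; apply: (f_equal2 +%R); last by rewrite VVp.
by apply: eq_dirD; apply: filterS VV => q ->.
Qed.

Lemma pullbackD V V' p v : smooth_sec f V p -> smooth_sec f V' p ->
  pullback f nb p v (fun q => V q + V' q) =
  pullback f nb p v V + pullback f nb p v V'.
Proof.
move=> sV sV'; rewrite /pullback; apply: etrans _ (addrACA _ _ _ _).
apply: (f_equal2 +%R) (nb_coordD hnb _ _ _ _).
exact: etrans (esym (eq_dirD v (scompsD hf V V' p))) (dirDD v sV sV').
Qed.

Lemma pullbackZ (u : M -> R) V p v : smooth_near u p -> smooth_sec f V p ->
  pullback f nb p v (fun q => u q *: V q) =
  dirD u p v *: V p + u p *: pullback f nb p v V.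
Proof.
move=> su sV; rewrite /pullback scalerDr addrA.
apply: (f_equal2 +%R) (nb_coordZ hnb _ _ _ _).
have := dirDZ v su sV; rewrite scomps_id => <-.
exact/esym/eq_dirD/scompsZ.
Qed.

Lemma pullback0 p v : pullback f nb p v (fun _ => 0) = 0.
Proof.
have := pullbackZ v (smooth_near_cst 0 p) (smooth_sec0 f p).
by rewrite /= !scaler0 scale0r addr0.
Qed.

Lemma pullback_sum (I : Type) (r : seq I) (F : I -> M -> 'rV[R]_N) p v :
  (forall i, smooth_sec f (F i) p) ->
  pullback f nb p v (fun q => \sum_(i <- r) F i q) =
  \sum_(i <- r) pullback f nb p v (F i).
Proof.
move=> sF; elim: r => [|i r IH].
  by under eq_fun do rewrite big_nil; rewrite big_nil pullback0.
under eq_fun do rewrite big_cons.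
rewrite big_cons -IH; apply: pullbackD => //.
exact: smooth_sec_sum.
Qed.

(** By [nbE] both sides carry the same Christoffel term, and the first-order terms agree by the
    chain rule. *)
Lemma pullback_imm (Z : vfield Mb) p v : smooth_vf_near Z (f p) ->
  pullback f nb p v (fun q => Z (f q)) = nb (f p) (tmap f p v) Z.
Proof.
move=> sZ; apply: etrans _ (esym (nbE hnb _ sZ)).
apply: (f_equal2 +%R) (erefl _).
exact: (@dirD_imm _ _ _ _ _ f hf _ (comps (f p) Z) p v sZ).
Qed.

Lemma pullback_linear V p : smooth_sec f V p ->
  linear (fun v => pullback f nb p v V).
Proof.
move=> sV c v w; rewrite /pullback.
have sc := smooth_coord_field (V p) (dom_mem (f p)).
have aux (a b x y : 'rV[R]_N) : c *: a + b + (c *: x + y) =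
    c *: (a + x) + (b + y) by rewrite scalerDr addrACA.
rewrite (dirD_linear sV) (tmap_linear hf) (conn_linear hnb sc).
exact: aux.
Qed.

(* In the frame E of coordinate fields the covariant derivative of a section is
   given by its Christoffel symbols, which are smooth by [conn_smooth]. *)
Lemma smooth_pullback X V p : smooth_vf_near X p -> smooth_sec f V p ->
  smooth_sec f (fun q => pullback f nb q (X q) V) p.
Proof.
move=> sX sV.
pose E j : vfield Mb := coord_field (f p) (delta_mx 0 j).
have sE j : smooth_vf_near (E j) (f p) by apply/smooth_coord_field/dom_mem.
have sVj j : smooth_near (fun q => scomps f p V q 0 j : R) p.
  exact: smooth_near_coord.
have sXj j : smooth_near (fun q => scomps f p (push f X) q 0 j : R) p.
  by apply: smooth_near_coord; exact: smooth_sec_push.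
pose G q := \sum_j
 (dirD (fun r => scomps f p V r 0 j : R) q (X q) *: E j (f q) +
  scomps f p V q 0 j *: \sum_k scomps f p (push f X) q 0 k *:
     nb (f q) (E k (f q)) (E j)).
have sG : smooth_sec f G p.
  apply: (smooth_sec_sum hf) => j; apply: (smooth_secD hf).
    apply: (smooth_secZ hf (smooth_dirD (sVj j) sX)).
    exact: (smooth_sec_imm hf (sE j)).
  apply: (smooth_secZ hf (sVj j)); apply: (smooth_sec_sum hf) => k.
  apply: (smooth_secZ hf (sXj k)).
  have sn := conn_smooth hnb (sE k) (sE j).
  exact: (smooth_sec_imm hf (Z := fun r : Mb => nb r (E k r) (E j)) sn).
apply: (eq_smooth_sec _ sG).
(* [V] is differentiated at [q], so its expansion must hold on a neighbourhood of each nearby [q],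
   whence [near_join]; for [push f X] the value at [q] is enough. *)
apply: filterS3 (near_join (sec_expand hf V p)) (near_imm_dom hf p)
  (filterI (smooth_near_near sV) (sec_expand hf (push f X) p)) => q Vq pq [sq Xq].
have sEq j : smooth_vf_near (E j) (f q) by apply: smooth_coord_field.
have sEi j : smooth_sec f (fun r => E j (f r)) q by exact: (smooth_sec_imm hf).
have sVq j : smooth_near (fun r => scomps f p V r 0 j : R) q.
  exact: smooth_near_coord.
apply: etrans (eq_pullback (X q) Vq).
have sVE j := smooth_secZ hf (sVq j) (sEi j).
apply: etrans (esym (pullback_sum _ (X q) sVE)); apply: eq_bigr => j _.
apply: etrans (esym (pullbackZ (X q) (sVq j) (sEi j))).
apply: (f_equal2 +%R (erefl _)); apply: (f_equal2 *:%R (erefl _)).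
apply: etrans (esym (pullback_imm (X q) (sEq j))).
have lin := conn_linear hnb (sEq j).
pose L : {linear 'rV[R]_N -> 'rV[R]_N} := HB.pack (fun v => nb (f q) v (E j))
  (GRing.isLinear.Build _ _ _ _ _ lin).
apply: etrans (congr1 L Xq).
apply: etrans (esym (linear_sum L _ _ _)); apply: eq_bigr => k _.
exact: esym (linearZZ L _ _).
Qed.

(** The Christoffel terms cancel by symmetry, and the first-order terms reduce to [dirD_bracket]
    applied to each coordinate of [f]. *)
Lemma pullback_torsion X Y p :
  (forall a (Z Z' : vfield Mb), smooth_vf_near Z a -> smooth_vf_near Z' a ->
     nb a (Z a) Z' - nb a (Z' a) Z = bracket Z Z' a) ->
  smooth_vf_near X p -> smooth_vf_near Y p ->
  pullback f nb p (X p) (push f Y) - pullback f nb p (Y p) (push f X) =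
  tmap f p (bracket X Y p).
Proof.
move=> tor sX sY; set a := f p; have aa := dom_mem a.
have sc w : smooth_vf_near (coord_field a w) a by exact: smooth_coord_field.
have comps_cst w : \forall r \near a, comps a (coord_field a w) r = w.
  by apply: filterS (near_dom aa) => q; exact: comps_coord_field.
(* Coordinate fields have constant components, so their brackets vanish and [tor] becomes the
   symmetry of the Christoffel terms. *)
have B0 w w' : bracket (coord_field a w) (coord_field a w') a = 0.
  have D0 x v : dirD (comps a (coord_field a x)) a v = 0.
    have e1 := @eq_dirD _ _ Mb _ (comps a (coord_field a x)) (fun=> x) a v
      (comps_cst x).
    apply: etrans e1 _.
    exact: (@dirD_cst _ _ Mb _ x a v).
  apply: etrans (f_equal2 (fun x y => x - y) (D0 w' (coord_field a w a))
    (D0 w (coord_field a w' a))) _.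
  exact: subrr.
have := tor a _ _ (sc (push f X p)) (sc (push f Y p)).
rewrite B0 !coord_field_id => /subr0_eq e.
have aux (b c x y : 'rV[R]_N) : x = y -> b + x - (c + y) = b - c.
  by move=> ->; rewrite opprD addrACA subrr addr0.
apply: etrans (aux _ _ _ _ e) _.
have sF := imm_smooth hf p.
have nF : \forall q \near p, forall v j,
    dirD (chart a) (f q) (tmap f q v) 0 j =
    dirD (fun q => chart a (f q) 0 j : R) q v.
  apply: filterS2 (near_imm_dom hf p) (smooth_near_near sF) => q pq sq v j.
  rewrite -(dirD_coord v j sq); congr (fun_of_matrix _ 0 j).
  exact/esym/(dirD_imm hf v (smooth_near_chart pq)).
apply/rowP => j; rewrite !mxE [in RHS](dirD_coord _ j sF).
have sj := smooth_near_coord 0 j sF.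
rewrite -(dirD_bracket sj sX sY).
have EX Z (sZ : smooth_vf_near Z p) v :
    dirD (fun q => dirD (chart a) (f q) (push f Z q)) p v 0 j =
    dirD (fun q => dirD (fun q => chart a (f q) 0 j : R) q (Z q) : R) p v.
  rewrite (dirD_coord v j (smooth_sec_push hf sZ)); apply: eq_dirD.
  by apply: filterS nF => q h; exact: (h (Z q) j).
apply: (f_equal2 +%R (EX Y sY (X p))).
by apply: (f_equal -%R (EX X sX (Y p))).
Qed.

End Pullback_connection.

(** * Orthogonal projection onto the tangent spaces of the submanifold *)

Section Orthogonal_projection.
Local Open Scope classical_set_scope.
Local Open Scope ring_scope.
Context {R : realType} {m N : nat} {M : manifold R m} {Mb : manifold R N}.
Variables (f : M -> Mb) (hf : immersion f).
Variables (g : Mb -> 'rV[R]_N -> 'rV[R]_N -> R) (hg : riemannian g).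
Implicit Types (p q : M) (X Y : vfield M) (V : M -> 'rV[R]_N).

Lemma gDl r u v w : g r (u + v) w = g r u w + g r v w.
Proof. by have := riem_linear hg r w 1 u v; rewrite scale1r mul1r. Qed.

Lemma g0l r w : g r 0 w = 0.
Proof. by have := gDl r 0 0 w; rewrite addr0 -{1}[g r 0 w]addr0 => /addrI. Qed.

Lemma gZl r c u w : g r (c *: u) w = c * g r u w.
Proof. by have := riem_linear hg r w c u 0; rewrite addr0 g0l addr0. Qed.

Lemma gBl r u v w : g r (u - v) w = g r u w - g r v w.
Proof. by rewrite gDl -scaleN1r gZl mulN1r. Qed.

Lemma g_suml r (I : Type) (s : seq I) (F : I -> 'rV[R]_N) w :
  g r (\sum_(i <- s) F i) w = \sum_(i <- s) g r (F i) w.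
Proof.
elim: s => [|i s IH]; first by rewrite !big_nil g0l.
by rewrite !big_cons gDl IH.
Qed.

Lemma g_sumr r (I : Type) (s : seq I) (F : I -> 'rV[R]_N) v :
  g r v (\sum_(i <- s) F i) = \sum_(i <- s) g r v (F i).
Proof.
by rewrite (riem_sym hg) g_suml; apply: eq_bigr => i _; rewrite (riem_sym hg).
Qed.

Lemma gZr r c v u : g r v (c *: u) = c * g r v u.
Proof. by rewrite (riem_sym hg) gZl (riem_sym hg). Qed.

Lemma g_eq0 r v : g r v v = 0 -> v = 0.
Proof.
move=> gv; have [//|v0] := eqVneq v 0.
by have := riem_pos hg r v0; rewrite gv ltxx.
Qed.

Lemma smooth_g V V' p : smooth_sec f V p -> smooth_sec f V' p ->
  smooth_near (fun q => g (f q) (V q) (V' q) : R) p.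
Proof.
move=> sV sV'; pose E j : vfield Mb := coord_field (f p) (delta_mx 0 j).
have sE j : smooth_vf_near (E j) (f p) by apply/smooth_coord_field/dom_mem.
apply: (@eq_smooth_near _ _ M _ (fun q => \sum_i scomps f p V q 0 i *
    \sum_j scomps f p V' q 0 j * g (f q) (E i (f q)) (E j (f q)))).
  apply: filterS2 (sec_expand hf V p) (sec_expand hf V' p) => q Vq V'q.
  rewrite -[in RHS]Vq -[in RHS]V'q g_suml; apply: eq_bigr => i _.
  by rewrite gZl g_sumr; congr (_ * _); apply: eq_bigr => j _; rewrite gZr.
apply: smooth_near_sum => i _; apply: smooth_nearM.
  exact: (smooth_near_coord 0 i sV).
apply: smooth_near_sum => j _; apply: smooth_nearM.
  exact: (smooth_near_coord 0 j sV').
exact: (smooth_near_imm hf (riem_smooth hg (sE i) (sE j))).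
Qed.

Lemma tmap_sum p (I : Type) (s : seq I) (F : I -> 'rV[R]_m) :
  tmap f p (\sum_(i <- s) F i) = \sum_(i <- s) tmap f p (F i).
Proof.
elim: s => [|i s IH]; first by rewrite !big_nil tmap0.
by rewrite !big_cons (tmapD hf) IH.
Qed.

Lemma tmap_eq0 p w : tmap f p w = 0 -> w = 0.
Proof. by rewrite -[RHS](tmap0 f p) => /(imm_inj hf). Qed.

Lemma normal_tmap p w : normal_vec f g p (tmap f p w) -> w = 0.
Proof. by move=> /(_ w) /g_eq0 /tmap_eq0. Qed.

Lemma normal0 p : normal_vec f g p 0.
Proof. by move=> w; exact: g0l. Qed.

Lemma normalD p u v : normal_vec f g p u -> normal_vec f g p v ->
  normal_vec f g p (u + v).
Proof. by move=> nu nv w; rewrite gDl nu nv addr0. Qed.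

Lemma normalZ p c u : normal_vec f g p u -> normal_vec f g p (c *: u).
Proof. by move=> nu w; rewrite gZl nu mulr0. Qed.

(** The difference of two candidates is both tangent and normal, hence zero by positivity of the
    metric and injectivity of the differential; so the choice made by [xget] is forced. *)
Lemma tanp_unique p v w : normal_vec f g p (v - tmap f p w) ->
  tanp f g p v = w.
Proof.
move=> nw; apply: xget_unique => // w' nw'.
apply/subr0_eq/(@normal_tmap p).
have aux (a b c : 'rV[R]_N) : a - c + (-1) *: (a - b) = b - c.
  by rewrite scaleN1r opprB addrC subrKA.
suff <- : v - tmap f p w + (-1) *: (v - tmap f p w') = tmap f p (w' - w).
  by apply: normalD nw _; exact: normalZ.
exact: etrans (aux _ _ _) (esym (tmapB hf _ _ _)).
Qed.

Definition gram p (E : 'I_m -> 'rV[R]_m) : 'M[R]_m :=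
  \matrix_(i, j) g (f p) (tmap f p (E i)) (tmap f p (E j)).

Definition gram_row p (E : 'I_m -> 'rV[R]_m) v : 'rV[R]_m :=
  \row_j g (f p) v (tmap f p (E j)).

Lemma gram_rowE p E (c : 'rV[R]_m) :
  gram_row p E (tmap f p (\sum_i c 0 i *: E i)) = c *m gram p E.
Proof.
apply/rowP => j; rewrite !mxE tmap_sum g_suml; apply: eq_bigr => i _.
by rewrite mxE (tmapZ hf) gZl.
Qed.

(** A row in the kernel of the Gram matrix gives a combination of the frame whose image has length
    zero. *)
Lemma gram_unit p E :
  (forall c : 'rV[R]_m, \sum_i c 0 i *: E i = 0 -> c = 0) -> gram p E \in unitmx.
Proof.
move=> freeE; rewrite -row_free_unit -kermx_eq0; apply/eqP/row_matrixP => i.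
rewrite row0; set c := row i _.
have cG : c *m gram p E = 0 by apply/sub_kermxP; exact: row_sub.
apply: freeE; apply: (@tmap_eq0 p); apply: (@g_eq0 (f p)).
rewrite {2}tmap_sum g_sumr big1// => j _; rewrite (tmapZ hf) gZr.
by have /rowP/(_ j) := gram_rowE p E c; rewrite cG !mxE => ->; rewrite mulr0.
Qed.

(** These coefficients solve the normal equations [c *m gram p E = gram_row p E v]. They give the
    existence of the projection and, in a coordinate frame, a formula that varies smoothly with the
    point. *)
Lemma tanp_gram p E v :
  (forall c : 'rV[R]_m, \sum_i c 0 i *: E i = 0 -> c = 0) ->
  (forall w, exists c : 'rV[R]_m, w = \sum_i c 0 i *: E i) ->
  normal_vec f g p (v - tmap f p
     (\sum_i (gram_row p E v *m invmx (gram p E)) 0 i *: E i)).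
Proof.
move=> freeE spanE; set x := v - _.
have xE j : g (f p) x (tmap f p (E j)) = 0.
  have /rowP/(_ j) := gram_rowE p E (gram_row p E v *m invmx (gram p E)).
  by rewrite /x gBl mulmxKV ?gram_unit// !mxE => ->; rewrite subrr.
move: x xE => x xE w; have [c ->] := spanE w.
by rewrite tmap_sum g_sumr big1// => j _; rewrite (tmapZ hf) gZr xE mulr0.
Qed.

Lemma coord_frame_free a q (c : 'rV[R]_m) : dom a q ->
  \sum_i c 0 i *: @coord_field _ _ M a (delta_mx 0 i) q = 0 -> c = 0.
Proof.
move=> aq; rewrite -coord_field_sum// => c0.
by rewrite -(comps_coord_field c aq) /comps c0 dirD0.
Qed.

Lemma coord_frame_span a q w : dom a q ->
  exists c : 'rV[R]_m, w = \sum_i c 0 i *: @coord_field _ _ M a (delta_mx 0 i) q.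
Proof.
by move=> aq; exists (dirD (chart a) q w); exact: coord_field_expand.
Qed.

Lemma tanp_coord a q v : dom a q ->
  let E i := @coord_field _ _ M a (delta_mx 0 i) q in
  tanp f g q v = \sum_i (gram_row q E v *m invmx (gram q E)) 0 i *: E i.
Proof.
move=> aq E; apply/tanp_unique/tanp_gram => [c|w].
  exact: coord_frame_free.
exact: coord_frame_span.
Qed.

Lemma tanpP p v : normal_vec f g p (v - tmap f p (tanp f g p v)).
Proof.
rewrite (tanp_coord _ (dom_mem p)); apply: tanp_gram => [c|w].
  exact/coord_frame_free/dom_mem.
exact/coord_frame_span/dom_mem.
Qed.

Lemma tanp_tmap p w : tanp f g p (tmap f p w) = w.
Proof. by apply: tanp_unique; rewrite subrr; exact: normal0. Qed.

Lemma tanpD p u v : tanp f g p (u + v) = tanp f g p u + tanp f g p v.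
Proof.
apply: tanp_unique; rewrite (tmapD hf) opprD addrACA.
by apply: normalD; exact: tanpP.
Qed.

Lemma tanpZ p c v : tanp f g p (c *: v) = c *: tanp f g p v.
Proof.
apply: tanp_unique; rewrite (tmapZ hf) -scalerBr; apply: normalZ; exact: tanpP.
Qed.

Lemma norpD p u v : norp f g p (u + v) = norp f g p u + norp f g p v.
Proof. by rewrite /norp tanpD (tmapD hf) opprD addrACA. Qed.

Lemma norpZ p c v : norp f g p (c *: v) = c *: norp f g p v.
Proof. by rewrite /norp tanpZ (tmapZ hf) scalerBr. Qed.

Lemma norp_tmap p w : norp f g p (tmap f p w) = 0.
Proof. by rewrite /norp tanp_tmap subrr. Qed.

Lemma smooth_det k (F : M -> 'M[R]_k) p :
  (forall i j, smooth_near (fun q => F q i j : R) p) ->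
  smooth_near (fun q => \det (F q) : R) p.
Proof.
move=> sF; rewrite /determinant; apply: smooth_near_sum => s _.
apply: smooth_nearM; first exact: smooth_near_cst.
by apply: smooth_near_prod => i; exact: sF.
Qed.

Lemma smooth_invmx k (F : M -> 'M[R]_k) p i j :
  (\forall q \near p, F q \in unitmx) ->
  (forall i j, smooth_near (fun q => F q i j : R) p) ->
  smooth_near (fun q => invmx (F q) i j : R) p.
Proof.
(* Cramer's formula: an entry of the inverse is a cofactor divided by the determinant, both
   polynomial in the entries of [F]. *)
move=> uF sF; apply: (@eq_smooth_near _ _ M _ (fun q => (\det (F q))^-1 *
    ((-1) ^+ (j + i) * \det (row' j (col' i (F q)))))).
  by apply: filterS uF => q uq; rewrite /invmx uq !mxE.
apply: smooth_nearM.
  apply: smooth_nearV; last exact: smooth_det.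
  by have := nbhs_singleton uF; rewrite unitmxE unitfE.
apply: smooth_nearM; first exact: smooth_near_cst.
by apply: smooth_det => i' j'; under eq_fun do rewrite !mxE; exact: sF.
Qed.

Lemma smooth_tanp V p : smooth_sec f V p ->
  smooth_vf_near (fun q => tanp f g q (V q)) p.
Proof.
move=> sV; have pp := dom_mem p.
pose E i : vfield M := coord_field p (delta_mx 0 i).
pose C q i := (gram_row q (E^~ q) (V q) *m invmx (gram q (E^~ q))) 0 i.
have sE i : smooth_vf_near (E i) p by exact: smooth_coord_field.
have sPE i : smooth_sec f (push f (E i)) p by exact: smooth_sec_push.
apply: (@eq_smooth_vf _ _ M (fun q => \sum_i C q i *: E i q)).
  by apply: filterS (near_dom pp) => q pq; exact/esym/(tanp_coord _ pq).
apply: smooth_vf_sum => i; apply: smooth_vfZ (sE i).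
rewrite /C; under eq_fun do rewrite mxE; apply: smooth_near_sum => j _.
apply: smooth_nearM.
  by under eq_fun do rewrite mxE; exact: (smooth_g sV (sPE j)).
apply: smooth_invmx.
  apply: filterS (near_dom pp) => q pq; apply: gram_unit => c.
  exact: coord_frame_free.
by move=> i' j'; under eq_fun do rewrite mxE; exact: (smooth_g (sPE i') (sPE j')).
Qed.

End Orthogonal_projection.

(** * Submanifolds of a Kenmotsu manifold tangent to xi *)

Section Kenmotsu_submanifold.
Local Open Scope classical_set_scope.
Local Open Scope ring_scope.
Context {R : realType} {m N : nat} {M : manifold R m} {Mb : manifold R N}.
Context {phi : Mb -> 'rV[R]_N -> 'rV[R]_N} {xi : vfield Mb}.
Context {eta : Mb -> 'rV[R]_N -> R} {g : Mb -> 'rV[R]_N -> 'rV[R]_N -> R}.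
Context {nb : conn Mb} {f : M -> Mb}.
Hypotheses (hK : kenmotsu phi xi eta g nb) (hf : immersion f).
Hypothesis xi_tangent : forall p, exists w, xi (f p) = tmap f p w.
Implicit Types (p q : M) (X Y Z W : vfield M).

Let hg := ken_g hK.
Let hnb : connection nb := lc_connection (ken_lc hK).
Local Notation snb := (semisymmetric xi eta g nb).
Local Notation xiM := (fun q => tanp f g q (xi (f q))).
Local Notation etaM p v := (eta (f p) (tmap f p v)).

Lemma tmap_xiM p : tmap f p (xiM p) = xi (f p).
Proof. by have [w ->] := xi_tangent p; rewrite (tanp_tmap hf hg). Qed.

Lemma push_xiM : push f xiM = fun q => xi (f q).
Proof. by apply/funext => q; exact: tmap_xiM. Qed.

Lemma etaME p v : etaM p v = imetric f g p v (xiM p).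
Proof. by rewrite (ken_eta_g hK) /imetric tmap_xiM. Qed.

Lemma imetric_xiM p : imetric f g p (xiM p) (xiM p) = 1.
Proof. by rewrite -etaME tmap_xiM (ken_eta_xi hK). Qed.

Lemma smooth_xiM p : smooth_vf_near xiM p.
Proof.
apply: (smooth_tanp hf hg); apply: (smooth_sec_imm hf).
exact: (ken_xi hK).
Qed.

Lemma smooth_imetric X Y p : smooth_vf_near X p -> smooth_vf_near Y p ->
  smooth_near (fun q => imetric f g q (X q) (Y q) : R) p.
Proof.
move=> sX sY.
exact: (smooth_g hf hg (smooth_sec_push hf sX) (smooth_sec_push hf sY)).
Qed.

Lemma smooth_etaM X p : smooth_vf_near X p ->
  smooth_near (fun q => etaM q (X q) : R) p.
Proof.
move=> sX; apply: eq_smooth_near (smooth_imetric sX (smooth_xiM p)).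
by apply: filterE => q; rewrite etaME.
Qed.

(** The correction in [semisymmetric] depends only on the value of the field, and by
    [coord_field_id] the coordinate field inside [pullback] takes the value [V p] at its base
    point. *)
Lemma pullback_semi p v V : pullback f snb p v V = pullback f nb p v V +
  tmap f p (eta (f p) (V p) *: v - g (f p) (tmap f p v) (V p) *: xiM p).
Proof.
rewrite (tmapB hf) !(tmapZ hf) tmap_xiM /pullback /semisymmetric coord_field_id.
have aux (a b c d : 'rV[R]_N) : a + (b + c - d) = a + b + (c - d).
  by rewrite !addrA.
exact: aux.
Qed.

Lemma sff_semi : sff f g snb = sff f g nb.
Proof.
apply/funext => X; apply/funext => Y; apply/funext => p.
apply: etrans (congr1 (norp f g p) (pullback_semi p (X p) (push f Y))) _.
by apply: etrans (norpD hf hg _ _ _) _; rewrite (norp_tmap hf hg) addr0.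
Qed.

Lemma inabla_semi X Y p : inabla f g snb X Y p = inabla f g nb X Y p +
  (etaM p (Y p) *: X p - imetric f g p (X p) (Y p) *: xiM p).
Proof.
apply: etrans (congr1 (tanp f g p) (pullback_semi p (X p) (push f Y))) _.
apply: etrans (tanpD hf hg _ _ _) _.
exact: (f_equal2 +%R (erefl _) (tanp_tmap hf hg _ _)).
Qed.

(** This disposes of the normal derivatives of h(Y, xi), which vanishes as a whole section and not
    just at one point. *)
Lemma nnabla_semi0 X : nnabla f g snb X (fun _ => 0) = fun _ => 0.
Proof.
apply/funext => p; have g0 v : g (f p) v 0 = 0 by rewrite (riem_sym hg) (g0l hg).
have := pullback_semi p (X p) (fun _ => 0).
rewrite (pullback0 hf hnb) add0r (ken_eta_g hK) (g0l hg) g0 !scale0r subr0.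
by rewrite /nnabla => ->; rewrite (norp_tmap hf hg).
Qed.

Lemma inabla_semi0 X : inabla f g snb X (fun _ => 0) = fun _ => 0.
Proof.
apply/funext => p; have g0 v : g (f p) v 0 = 0 by rewrite (riem_sym hg) (g0l hg).
have push0 : push f (fun _ : M => 0) = fun _ => 0.
  by apply/funext => q; exact: tmap0.
have := pullback_semi p (X p) (fun _ => 0).
rewrite (pullback0 hf hnb) add0r (ken_eta_g hK) (g0l hg) g0 !scale0r subr0.
by rewrite /inabla push0 => ->; rewrite (tanp_tmap hf hg).
Qed.

(** This is the tangential part of [pullback_torsion]; [sff_sym] is the normal part. *)
Lemma inabla_torsion X Y p : smooth_vf_near X p -> smooth_vf_near Y p ->
  inabla f g nb X Y p = inabla f g nb Y X p + bracket X Y p.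
Proof.
move=> sX sY.
have := pullback_torsion hf
  (fun a V V' => @lc_torsion _ _ _ _ _ (ken_lc hK) a V V') sX sY.
move/eqP; rewrite subr_eq addrC => /eqP e.
apply: etrans (congr1 (tanp f g p) e) _.
apply: etrans (tanpD hf hg _ _ _) _.
exact: (f_equal2 +%R (erefl _) (tanp_tmap hf hg _ _)).
Qed.

Lemma sff_sym X Y p : smooth_vf_near X p -> smooth_vf_near Y p ->
  sff f g nb X Y p = sff f g nb Y X p.
Proof.
move=> sX sY.
have := pullback_torsion hf
  (fun a V V' => @lc_torsion _ _ _ _ _ (ken_lc hK) a V V') sX sY.
move/eqP; rewrite subr_eq addrC => /eqP e.
apply: etrans (congr1 (norp f g p) e) _.
apply: etrans (norpD hf hg _ _ _) _.
by rewrite (norp_tmap hf hg) addr0.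
Qed.

Lemma pullback_xiM p v : pullback f nb p v (push f xiM) =
  tmap f p (v - etaM p v *: xiM p).
Proof.
rewrite push_xiM (tmapB hf) (tmapZ hf) tmap_xiM.
apply: etrans (pullback_imm hf hnb v (ken_xi hK (f p))) _.
exact: (ken_nabla_xi hK).
Qed.

Lemma sff_xiM X : sff f g nb X xiM = fun _ => 0.
Proof.
apply/funext => p.
apply: etrans (congr1 (norp f g p) (pullback_xiM p (X p))) _.
exact: (norp_tmap hf hg).
Qed.

Lemma inabla_xiM X p : inabla f g nb X xiM p = X p - etaM p (X p) *: xiM p.
Proof.
apply: etrans (congr1 (tanp f g p) (pullback_xiM p (X p))) _.
exact: (tanp_tmap hf hg).
Qed.

Lemma inabla_semi_xiM X : inabla f g snb X xiM =
  fun q => 2 *: X q + (- 2 * etaM q (X q)) *: xiM q.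
Proof.
apply/funext => p; apply: etrans (inabla_semi X xiM p) _.
rewrite inabla_xiM -etaME tmap_xiM (ken_eta_xi hK).
by apply/rowP => j; rewrite !mxE; ring.
Qed.

(* By symmetry [sff] is tensorial in its second argument, and it kills [xiM]. *)
Lemma sff_comb X Y W (c d : R) p :
  smooth_vf_near X p -> smooth_vf_near Y p -> smooth_vf_near W p ->
  W p = c *: X p + d *: xiM p -> sff f g nb Y W p = c *: sff f g nb Y X p.
Proof.
move=> sX sY sW Wp; have sxi := smooth_xiM p.
have lin := pullback_linear hf hnb (smooth_sec_push hf sY).
pose L : {linear 'rV[R]_m -> 'rV[R]_N} :=
  HB.pack (fun v => pullback f nb p v (push f Y))
  (GRing.isLinear.Build _ _ _ _ _ lin).
have L0 : norp f g p (L (xiM p)) = 0.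
  by apply: etrans (sff_sym sxi sY) _; rewrite sff_xiM.
rewrite (sff_sym sY sW) (sff_sym sY sX).
apply: etrans (congr1 (fun v => norp f g p (L v)) Wp) _.
rewrite linearD !linearZZ; apply: etrans (norpD hf hg _ _ _) _.
have aux (a : 'rV[R]_N) : a + d *: 0 = a by rewrite scaler0 addr0.
apply: etrans (aux _); apply: (f_equal2 +%R (norpZ hf hg p c _)).
apply: etrans (norpZ hf hg p d _) _.
exact: (congr1 ( *:%R d) L0).
Qed.

Lemma smooth_inabla X Y : smooth_vf X -> smooth_vf Y ->
  smooth_vf (inabla f g nb X Y).
Proof.
move=> sX sY p; apply: (smooth_tanp hf hg).
exact: (smooth_pullback hf hnb (sX p) (smooth_sec_push hf (sY p))).
Qed.

Lemma smooth_vfB X Y : smooth_vf X -> smooth_vf Y ->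
  smooth_vf (fun q => X q - Y q).
Proof.
move=> sX sY p.
apply: (@eq_smooth_vf _ _ M (fun q => X q + (-1) *: Y q)).
  by apply: filterE => q; rewrite scaleN1r.
exact: smooth_vfD (sX p) (smooth_vfZ (smooth_near_cst (-1 : R) p) (sY p)).
Qed.

Lemma smooth_inabla_semi X Y : smooth_vf X -> smooth_vf Y ->
  smooth_vf (inabla f g snb X Y).
Proof.
move=> sX sY p.
apply: (@eq_smooth_vf _ _ M (fun q => inabla f g nb X Y q +
    (etaM q (Y q) *: X q - imetric f g q (X q) (Y q) *: xiM q))).
  by apply: filterE => q; exact: esym (inabla_semi X Y q).
apply: smooth_vfD; first exact: (smooth_inabla sX sY p).
have s1 : smooth_vf (fun q => etaM q (Y q) *: X q).
  by move=> q; exact: smooth_vfZ (smooth_etaM (sY q)) (sX q).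
have s2 : smooth_vf (fun q => imetric f g q (X q) (Y q) *: xiM q).
  by move=> q; exact: smooth_vfZ (smooth_imetric (sX q) (sY q)) (smooth_xiM q).
exact: smooth_vfB s1 s2 p.
Qed.

(** Vanishing torsion expresses the bracket through the induced connection, so its definition, whose
    chart changes with the point, need not be differentiated. *)
Lemma smooth_bracket X Y : smooth_vf X -> smooth_vf Y -> smooth_vf (bracket X Y).
Proof.
move=> sX sY p.
apply: (@eq_smooth_vf _ _ M (fun q => inabla f g nb X Y q - inabla f g nb Y X q)).
  apply: filterE => q; apply/eqP; rewrite subr_eq addrC; apply/eqP.
  exact: inabla_torsion (sX q) (sY q).
exact: smooth_vfB (smooth_inabla sX sY) (smooth_inabla sY sX) p.
Qed.

Lemma smooth_curvature X Y Z : smooth_vf X -> smooth_vf Y -> smooth_vf Z ->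
  smooth_vf (curvature (inabla f g snb) X Y Z).
Proof.
move=> sX sY sZ; have sn := smooth_inabla_semi.
have s1 := sn _ _ sX (sn _ _ sY sZ); have s2 := sn _ _ sY (sn _ _ sX sZ).
exact: smooth_vfB (smooth_vfB s1 s2) (sn _ _ (smooth_bracket sX sY) sZ).
Qed.

Lemma inabla_comb X (u : M -> R) p : smooth_vf_near X p -> smooth_near u p ->
  inabla f g nb xiM (fun q => 2 *: X q + u q *: xiM q) p =
  2 *: inabla f g nb xiM X p + dirD u p (xiM p) *: xiM p.
Proof.
move=> sX su; have sPX := smooth_sec_push hf sX.
have sP := smooth_sec_push hf (smooth_xiM p).
have s2 := smooth_near_cst (2 : R) p.
(* nabla_xi xi = xi - eta(xi) xi = 0, so the coefficient [u] enters only through its derivative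
   along xi. *)
have P0 : pullback f nb p (xiM p) (push f xiM) = 0.
  by rewrite pullback_xiM tmap_xiM (ken_eta_xi hK) scale1r subrr; exact: tmap0.
have Ep : push f (fun q => 2 *: X q + u q *: xiM q) =
    fun q => 2 *: push f X q + u q *: push f xiM q.
  by apply/funext => q; apply: etrans (tmapD hf _ _ _) _; rewrite !(tmapZ hf).
apply: etrans (congr1 (fun V => tanp f g p (pullback f nb p (xiM p) V)) Ep) _.
have aux1 (a b : 'rV[R]_N) : (0 : R) *: a + b = b by rewrite scale0r add0r.
have aux2 (a : 'rV[R]_N) (c : R) : a + c *: 0 = a by rewrite scaler0 addr0.
have e1 : pullback f nb p (xiM p) (fun q => 2 *: push f X q) =
    2 *: pullback f nb p (xiM p) (push f X).
  apply: etrans (pullbackZ hf hnb (xiM p) s2 sPX) _.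
  by apply: etrans (aux1 (push f X p) _); rewrite dirD_cst.
have e2 : pullback f nb p (xiM p) (fun q => u q *: push f xiM q) =
    dirD u p (xiM p) *: push f xiM p.
  apply: etrans (pullbackZ hf hnb (xiM p) su sP) _.
  by apply: etrans (aux2 _ (u p)); rewrite P0.
apply: etrans (congr1 (tanp f g p) (pullbackD hf hnb (xiM p)
  (smooth_secZ hf s2 sPX) (smooth_secZ hf su sP))) _.
apply: etrans (congr1 (tanp f g p) (f_equal2 +%R e1 e2)) _.
apply: etrans (tanpD hf hg _ _ _) _.
apply: (f_equal2 +%R); first exact: (tanpZ hf hg).
apply: etrans (tanpZ hf hg _ _ _) _.
exact: (congr1 (fun v => _ *: v) (tanp_tmap hf hg _ _)).
Qed.

(** As tilde-nabla_xi xi = 0, the first term vanishes, and modulo xi the other two are - 2 nabla_xi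
    X and - 2 [X, xi], with sum - 2 nabla_X xi. The coefficient [d] stays existential because
    [sff_comb] accepts any. *)
Lemma curvature_xiM X p : smooth_vf X -> exists d : R,
  curvature (inabla f g snb) X xiM xiM p = - 2 *: X p + d *: xiM p.
Proof.
move=> sX; have sxi q := smooth_xiM q.
have e1 : inabla f g snb xiM xiM = fun _ => 0.
  rewrite inabla_semi_xiM; apply/funext => q.
  by rewrite tmap_xiM (ken_eta_xi hK) -scalerDl mulr1 subrr scale0r.
have su : smooth_near (fun q => - 2 * etaM q (X q) : R) p.
  exact: smooth_nearM (smooth_near_cst _ p) (smooth_etaM (sX p)).
(* Here [T], [x], [V], [B] stand for nabla_xi X, xi, X and [X, xi]; the hypothesis is nabla_X xi =
   nabla_xi X + [X, xi], supplied by [e5]. *)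
have aux (T x V B : 'rV[R]_m) (c1 c2 c3 c4 c5 : R) : V - c4 *: x = T + B ->
    exists d, 0 - (2 *: T + c1 *: x + (c2 *: x - c3 *: x)) -
    (2 *: B + (- 2 * c5) *: x) = - 2 *: V + d *: x.
  move=> e; exists (- c1 - c2 + c3 + 2 * c4 - 2 * (- c5)).
  have -> : B = V - c4 *: x - T by rewrite e addrC addKr.
  by apply/rowP => j; rewrite !mxE; ring.
have e2 : inabla f g snb X (inabla f g snb xiM xiM) p = 0.
  by rewrite e1 inabla_semi0.
have e3 := etrans
  (congr1 (fun Y => inabla f g snb xiM Y p) (inabla_semi_xiM X))
  (etrans (inabla_semi xiM _ p) (f_equal2 +%R (inabla_comb (sX p) su) (erefl _))).
have e4 := congr1 (fun Y => Y p) (inabla_semi_xiM (bracket X xiM)).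
have e5 := etrans (esym (inabla_xiM X p)) (inabla_torsion (sX p) (sxi p)).
pose A := 2 *: X p + (- 2 * etaM p (X p)) *: xiM p.
have [d Hd] := aux _ _ _ (bracket X xiM p)
  (dirD (fun q => - 2 * etaM q (X q) : R) p (xiM p)) (etaM p A)
  (imetric f g p (xiM p) A) _ (etaM p (bracket X xiM p)) e5.
exists d.
apply: etrans (f_equal2 +%R (f_equal2 +%R e2 (congr1 -%R e3)) (congr1 -%R e4)) _.
exact: Hd.
Qed.

Lemma curvature_nnabla0 X Y :
  curvature (nnabla f g snb) X Y (fun _ => 0) = fun _ => 0.
Proof.
by apply/funext => p; rewrite /curvature !nnabla_semi0 !subr0.
Qed.

(** Only - h(Z, tilde-R(X, xi) xi) survives, since the other two terms have xi in the second slot of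
    h. *)
Lemma curv_sff_xiM X Z p : smooth_vf X -> smooth_vf Z ->
  curv_sff f g snb X xiM Z xiM p = 2 *: sff f g nb Z X p.
Proof.
move=> sX sZ; have [d Hd] := curvature_xiM p sX.
have sxi : smooth_vf xiM by exact: smooth_xiM.
have e3 := sff_comb (sX p) (sZ p) (smooth_curvature sX sxi sxi p) Hd.
have aux (a : 'rV[R]_N) : 0 - 0 - (- 2) *: a = 2 *: a.
  by rewrite !sub0r scaleNr opprK oppr0 add0r.
rewrite /curv_sff sff_semi !sff_xiM curvature_nnabla0.
apply: etrans (aux _).
exact: (f_equal2 +%R (erefl _) (congr1 -%R e3)).
Qed.

Lemma nabla_sff_xiM X Y p : smooth_vf X -> smooth_vf Y ->
  nabla_sff f g snb X Y xiM p = - 2 *: sff f g nb Y X p.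
Proof.
move=> sX sY; have sxi : smooth_vf xiM by exact: smooth_xiM.
have Hd := congr1 (fun W => W p) (inabla_semi_xiM X).
have e3 := sff_comb (sX p) (sY p) (smooth_inabla_semi sX sxi p) Hd.
have aux (a : 'rV[R]_N) : 0 - 0 - 2 *: a = - 2 *: a.
  by rewrite !sub0r scaleNr oppr0 add0r.
rewrite /nabla_sff sff_semi !sff_xiM nnabla_semi0.
apply: etrans (aux _).
exact: (f_equal2 +%R (erefl _) (congr1 -%R e3)).
Qed.

(** Every term but g(xi, xi) h(X, Z) contains h with xi in some slot, and xi has unit length. *)
Lemma Q_sff_xiM X Z p : smooth_vf X -> smooth_vf Z ->
  Q_sff f g snb Z xiM X xiM p = sff f g nb Z X p.
Proof.
move=> sX sZ; have sxi : smooth_vf xiM by exact: smooth_xiM.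
have eZ : sff f g nb xiM Z p = 0.
  by apply: etrans (sff_sym (sxi p) (sZ p)) _; rewrite sff_xiM.
have eX := sff_sym (sX p) (sZ p).
have aux (a b c d : R) (v w : 'rV[R]_N) : c = 1 -> w = 0 ->
    a *: 0 - b *: 0 + c *: v - d *: w = v.
  by move=> -> ->; rewrite !scaler0 !subr0 scale1r add0r.
rewrite /Q_sff sff_semi !sff_xiM.
by apply: etrans (aux _ _ _ _ _ _ (imetric_xiM p) eZ) eX.
Qed.

Lemma geodesic_nabla_sff X Y Z p : totally_geodesic f g nb ->
  smooth_vf X -> smooth_vf Y -> smooth_vf Z -> nabla_sff f g snb X Y Z p = 0.
Proof.
move=> h sX sY sZ; have sn := smooth_inabla_semi.
have e1 : sff f g nb Y Z = fun _ => 0 by apply/funext => q; exact: h.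
have e2 := h _ _ (sn _ _ sX sY) sZ p; have e3 := h _ _ sY (sn _ _ sX sZ) p.
rewrite /nabla_sff sff_semi e1 nnabla_semi0.
apply: etrans (_ : 0 - 0 - 0 = _); last by rewrite !subr0.
exact: (f_equal2 +%R (f_equal2 +%R (erefl _) (congr1 -%R e2)) (congr1 -%R e3)).
Qed.

Lemma geodesic_curv_sff X Y Z U p : totally_geodesic f g nb ->
  smooth_vf X -> smooth_vf Y -> smooth_vf Z -> smooth_vf U ->
  curv_sff f g snb X Y Z U p = 0.
Proof.
move=> h sX sY sZ sU; have sn := smooth_curvature sX sY.
have e1 : sff f g nb Z U = fun _ => 0 by apply/funext => q; exact: h.
have e2 := h _ _ (sn _ sZ) sU p; have e3 := h _ _ sZ (sn _ sU) p.
rewrite /curv_sff sff_semi e1 curvature_nnabla0.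
apply: etrans (_ : 0 - 0 - 0 = _); last by rewrite !subr0.
exact: (f_equal2 +%R (f_equal2 +%R (erefl _) (congr1 -%R e2)) (congr1 -%R e3)).
Qed.

Lemma geodesic_chaki : totally_geodesic f g nb ->
  exists alpha : M -> 'rV[R]_m -> R,
    [/\ one_form alpha, forall p, exists v, alpha p v != 0,
        forall p, alpha p (xiM p) != -2 & chaki_pseudo_parallel f g snb alpha].
Proof.
move=> h; exists (fun p v => etaM p v).
(* This value serves twice: it shows that eta vanishes nowhere, and it differs from - 2 because 1 +
   2 is nonzero. *)
have exi p : etaM p (xiM p) = 1 by rewrite etaME imetric_xiM.
split.
- split=> [p c v w|p X]; last exact: smooth_etaM.
  by rewrite /= !etaME /imetric (tmap_linear hf) (gDl hg) (gZl hg).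
- by move=> p; exists (xiM p); rewrite exi oner_eq0.
- by move=> p; rewrite exi -subr_eq0 opprK -(natrD _ 1 2) pnatr_eq0.
- move=> X Y Z sX sY sZ p; rewrite (geodesic_nabla_sff p h sX sY sZ) sff_semi.
  by rewrite !h// !scaler0 !addr0.
Qed.

(** With xi as third field the right-hand side reduces to alpha(xi) h(X, Y) and the left-hand side
    is - 2 h(Y, X), so (- 2 - alpha(xi)) h(Y, X) = 0: the excluded value is exactly where the factor
    vanishes. *)
Lemma chaki_geodesic (alpha : M -> 'rV[R]_m -> R) :
  (forall p, alpha p (xiM p) != -2) -> chaki_pseudo_parallel f g snb alpha ->
  totally_geodesic f g nb.
Proof.
move=> a2 h Y X sY sX p.
have sxi : smooth_vf xiM by exact: smooth_xiM.
have := h X Y xiM sX sY sxi p.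
rewrite (nabla_sff_xiM p sX sY) sff_semi !sff_xiM (sff_sym (sX p) (sY p)).
rewrite !scaler0 !add0r => /eqP; rewrite -subr_eq0 -scalerBl scaler_eq0 subr_eq0.
by rewrite eq_sym (negbTE (a2 p)) => /eqP.
Qed.

Lemma parallel_geodesic : parallel f g snb -> totally_geodesic f g nb.
Proof.
move=> h Y X sY sX p; have sxi : smooth_vf xiM by exact: smooth_xiM.
have := h X Y xiM sX sY sxi p; rewrite (nabla_sff_xiM p sX sY) => /eqP.
by rewrite scaler_eq0 oppr_eq0 pnatr_eq0 => /eqP.
Qed.

(** Evaluation at xi gives 2 h(Z, X) = L h(Z, X), and the factor 2 - L is invertible. *)
Lemma deszcz_geodesic (L : M -> R) : (forall p, L p != 2) ->
  deszcz_pseudo_parallel f g snb L -> totally_geodesic f g nb.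
Proof.
move=> L2 h Z X sZ sX p; have sxi : smooth_vf xiM by exact: smooth_xiM.
have := h X xiM Z xiM sX sxi sZ sxi p.
rewrite (curv_sff_xiM p sX sZ) (Q_sff_xiM p sX sZ) => /eqP.
rewrite -subr_eq0 -scalerBl scaler_eq0 subr_eq0.
by rewrite eq_sym (negbTE (L2 p)) => /eqP.
Qed.

(** Semiparallelism is the Deszcz condition with L = 0, an admissible value. *)
Lemma semiparallel_geodesic : semiparallel f g snb -> totally_geodesic f g nb.
Proof.
move=> h; apply: (@deszcz_geodesic (fun=> 0)) => [p|X Y Z U sX sY sZ sU p].
  by rewrite eq_sym pnatr_eq0.
by rewrite scale0r; exact: h.
Qed.

End Kenmotsu_submanifold.

(** * The equivalence of the five conditions *)

Theorem theorem4p4 (R : realType) (n m : nat)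
    (Mb : manifold R (n.*2.+1))
    (phi : Mb -> 'rV[R]_(n.*2.+1) -> 'rV[R]_(n.*2.+1))
    (xi : vfield Mb)
    (eta : Mb -> 'rV[R]_(n.*2.+1) -> R)
    (g : Mb -> 'rV[R]_(n.*2.+1) -> 'rV[R]_(n.*2.+1) -> R)
    (nb : conn Mb) (hMb : kenmotsu phi xi eta g nb)
    (M : manifold R m) (f : M -> Mb) (D : M -> {vspace 'rV[R]_m})
    (hM : contact_CR f phi xi g D) :
  let snb := semisymmetric xi eta g nb in
  [<-> totally_geodesic f g nb;
       parallel f g snb;
       semiparallel f g snb;
       exists alpha : M -> 'rV[R]_m -> R,
         [/\ one_form alpha,
             forall p, exists v, alpha p v != 0,
             forall p, alpha p (tanp f g p (xi (f p))) != -2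
           & chaki_pseudo_parallel f g snb alpha];
       exists2 L1 : M -> R, forall p, L1 p != 2
         & deszcz_pseudo_parallel f g snb L1].
Proof.
move=> snb; have hf := cr_immersion hM.
have xi_tangent p : exists w, xi (f p) = tmap f p w.
  by have [w _ e] := cr_xi hM p; exists w.
(* The implications form a cycle; each one starting from (ii)-(v) first recovers h = 0 and deduces
   the next condition from that. *)
tfae.
- by move=> h X Y Z sX sY sZ p; exact: (geodesic_nabla_sff hMb).
- move=> /(parallel_geodesic hMb hf xi_tangent) h X Y Z U sX sY sZ sU p.
  exact: (geodesic_curv_sff hMb).
- move=> /(semiparallel_geodesic hMb hf xi_tangent) h.
  exact: (geodesic_chaki hMb).
- case=> alpha [_ _ a2 /(chaki_geodesic hMb hf xi_tangent a2) h].
  exists (fun=> 0) => [p|X Y Z U sX sY sZ sU p]; first by rewrite eq_sym pnatr_eq0.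
  by rewrite scale0r; exact: (geodesic_curv_sff hMb).
- case=> L L2; exact: (deszcz_geodesic hMb hf xi_tangent L2).
Qed.
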